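(* Assume (A1), (A2), (A3) (see context), $\theta_i\in(0,2)$, $\alpha_i>0$, $\gamma_i>0$, $0<\gamma_i\beta<1/\lambda_{\max}(L)$ and $\sum_{k=0}^\infty\varepsilon_i^k<\infty$ for all $i$. Let $\{\xi^k\},\{\widehat\xi^k\},\{V^k\}$ be generated by the inexact DPMM algorithm. Then for all $k\ge0$ $$\|M(\xi^{k+1}-\widehat\xi^{k+1})\|_{\mathbf H}^2+\|(\xi^k-\widehat\xi^k)-(\xi^{k+1}-\widehat\xi^{k+1})\|_{\mathbf D}^2\le\|M(\xi^k-\widehat\xi^k)\|_{\mathbf H}^2+2\langle\widehat\xi^k-\widehat\xi^{k+1},V^k-V^{k+1}\rangle.$$ Furthermore, if $\varepsilon_i^k=O((\tau_i)^k)$ for some $\tau_i\in(0,1)$, $i=1,\dots,m$, and $\tau_{\max}=\max_i\tau_i$, then (a) $\|\xi^{k+1}-\xi^k\|_{\mathbf H}^2=o(1/k)+O((\tau_{\max})^k)$; (b) $\mathrm{dist}^2\big(0,\Phi(\widehat{\mathrm x}^k,\widehat{\mathrm Y}^k,\widehat{\mathrm Z}^k)\big)=o(1/k)+O((\tau_{\max})^k)$.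
   Context: Problem. Let $m\ge2$, $n_1,\dots,n_m\ge1$, $p,q\ge0$ be integers, $n=\sum_i n_i$, $\mathcal V=\{1,\dots,m\}$. For $i\in\mathcal V$ let $f_i:\mathbb R^{n_i}\to\mathbb R$, $A_i\in\mathbb R^{p\times n_i}$, $b_i\in\mathbb R^p$, $g_i:\mathbb R^{n_i}\to\mathbb R^q$, $\Omega_i\subseteq\mathbb R^{n_i}$, and $G_i(\mathrm x_i)=\mathrm{col}(A_i\mathrm x_i-b_i,\,g_i(\mathrm x_i))\in\mathbb R^{p+q}$. Let $\mathcal K=\{0_p\}\times\mathbb R^q_-$ and $\mathcal K^\circ=\mathbb R^p\times\mathbb R^q_+$. Problem (P): minimize $F(\mathrm x)=\sum_i f_i(\mathrm x_i)$ over $\mathrm x=\mathrm{col}(\mathrm x_1,\dots,\mathrm x_m)\in\mathbb R^n$ subject to $\sum_iG_i(\mathrm x_i)\in\mathcal K$ and $\mathrm x_i\in\Omega_i$ for all $i$. With $\delta_S$ the indicator function of a set $S$, put $\ell_i(\mathrm x_i,\mathrm y)=f_i(\mathrm x_i)+\mathrm y^\top G_i(\mathrm x_i)+\delta_{\Omega_i}(\mathrm x_i)-\delta_{\mathcal K^\circ}(\mathrm y)$. Assumptions. (A1) $\mathcal G=(\mathcal V,\mathcal E)$ is a connected undirected graph; $L\in\mathbb R^{m\times m}$ is symmetric and compatible with $\mathcal G$ ($L_{ij}=0$ whenever $i\ne j$, $(i,j)\notin\mathcal E$, and $\mathrm{null}(L)=\mathrm{span}\{\mathbf 1_m\}$),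 and $L=U^\top U$ for a full-row-rank $U\in\mathbb R^{r\times m}$ with $U\mathbf 1_m=0$. (A2) each $f_i$ and each component of $g_i$ is proper closed convex, each $\Omega_i$ nonempty closed convex, and (P) has an optimal solution. (A3) there is $\bar{\mathrm x}$ with $\bar{\mathrm x}_i\in\mathrm{int}(\Omega_i)$, $\sum_i(A_i\bar{\mathrm x}_i-b_i)=0$, $\sum_ig_i(\bar{\mathrm x}_i)<0$. Operator. $\mathbf L=L\otimes I_{p+q}$, $\mathbf U=U\otimes I_{p+q}$. For $\mathrm Y=\mathrm{col}(\mathrm y_1,\dots,\mathrm y_m)$, $\mathcal L(\mathrm x,\mathrm Y)=\sum_i\ell_i(\mathrm x_i,\mathrm y_i)$; $\partial_{\mathrm x}\mathcal L$ is the subdifferential in $\mathrm x$ and $\partial_{\mathrm Y}\mathcal L:=-\partial_{\mathrm Y}[-\mathcal L]$. For $\mathrm Z\in\mathbb R^{r(p+q)}$, $\Phi(\mathrm x,\mathrm Y,\mathrm Z)=\partial_{\mathrm x}\mathcal L(\mathrm x,\mathrm Y)\times(-\partial_{\mathrm Y}\mathcal L(\mathrm x,\mathrm Y)+\mathbf U^\top\mathrm Z)\times\{-\mathbf U\mathrm Y\}$; $\mathrm{dist}(0,S)=\inf_{s\in S}\|s\|$. Matrices. Parameters $\theta_i,\alpha_i,\gamma_i>0$, $\beta>0$; $\Theta=\mathrm{diag}(\theta_iI_{n_i})_i$, $\Upsilon=\mathrm{diag}(\alpha_iI_{n_i})_i$, $\Gamma=\mathrm{diag}(\gamma_iI_{p+q})_i$;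 $Q=\begin{pmatrix}\Upsilon^{-1}&0&0\\0&\Gamma^{-1}&-\mathbf U^\top\\0&0&\frac1\beta I\end{pmatrix}$, $M=\begin{pmatrix}\Theta&0&0\\0&I&-\Gamma\mathbf U^\top\\0&0&I\end{pmatrix}$, $\mathbf H=QM^{-1}$, $\mathbf D=Q^\top+Q-M^\top\mathbf HM$, $\|v\|_{\mathbf H}^2=\langle v,\mathbf Hv\rangle$ (similarly for $\mathbf D$). Algorithm (inexact DPMM). $\mathcal P_{\mathcal K^\circ}(u_1,u_2)=(u_1,\max(u_2,0))$. Initialize $\mathrm x_i^0\in\Omega_i$, $\mathrm y_i^0\in\mathcal K^\circ$, $\lambda_i^0=0$. At iteration $k$, agent $i$ chooses $\varepsilon_i^k\ge0$, sets $\phi_i^k(\mathrm x_i,\mathrm y_i)=f_i(\mathrm x_i)+\frac1{2\gamma_i}(\|\mathcal P_{\mathcal K^\circ}(\mathrm y_i+\gamma_iG_i(\mathrm x_i))\|^2-\|\mathrm y_i\|^2)+\frac1{2\alpha_i}\|\mathrm x_i-\mathrm x_i^k\|^2+\delta_{\Omega_i}(\mathrm x_i)$, computes $\widehat{\mathrm x}_i^k$ and $v_i^k\in\partial_{\mathrm x_i}\phi_i^k(\widehat{\mathrm x}_i^k,\mathrm y_i^k-\gamma_i\lambda_i^k)$ with $\|v_i^k\|\le\varepsilon_i^k$, then $\widehat{\mathrm y}_i^k=\mathcal P_{\mathcal K^\circ}(\mathrm y_i^k-\gamma_i\lambda_i^k+\gamma_iG_i(\widehat{\mathrm x}_i^k))$,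 $\mathrm x_i^{k+1}=(1-\theta_i)\mathrm x_i^k+\theta_i\widehat{\mathrm x}_i^k$, $\lambda_i^{k+1}=\lambda_i^k+\beta\sum_jL_{ij}\widehat{\mathrm y}_j^k$, $\mathrm y_i^{k+1}=\widehat{\mathrm y}_i^k+\gamma_i(\lambda_i^k-\lambda_i^{k+1})$. Stack $\mathrm x^k,\mathrm Y^k,\Lambda^k=\mathrm{col}(\lambda_i^k),\widehat{\mathrm x}^k,\widehat{\mathrm Y}^k$; $\mathrm Z^k$ is the unique vector with $\Lambda^k=\mathbf U^\top\mathrm Z^k$, $\widehat{\mathrm Z}^k$ the one with $\Lambda^{k+1}=\mathbf U^\top\widehat{\mathrm Z}^k$; $\xi^k=\mathrm{col}(\mathrm x^k,\mathrm Y^k,\mathrm Z^k)$, $\widehat\xi^k=\mathrm{col}(\widehat{\mathrm x}^k,\widehat{\mathrm Y}^k,\widehat{\mathrm Z}^k)$, $V^k=\mathrm{col}(v_1^k,\dots,v_m^k,0,0)$. *)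

(* Defs.v *)
From HB Require Import structures.
From mathcomp Require Import all_boot all_order all_algebra.
From mathcomp Require Import all_classical all_reals all_analysis.
Set Implicit Arguments. Unset Strict Implicit. Unset Printing Implicit Defensive.
Import Order.TTheory GRing.Theory Num.Theory.
Import numFieldNormedType.Exports.
Local Open Scope classical_set_scope.
Local Open Scope ring_scope.

Definition inner (R : realType) (N : nat) (u v : 'cV[R]_N) : R := (u^T *m v) 0 0.
Definition sqnorm (R : realType) (N : nat) (u : 'cV[R]_N) : R := inner u u.
Definition enorm (R : realType) (N : nat) (u : 'cV[R]_N) : R := Num.sqrt (sqnorm u).
Definition wsqnorm (R : realType) (N : nat) (W : 'M[R]_N) (u : 'cV[R]_N) : R :=
  inner u (W *m u).
Definition dist0 (R : realType) (N : nat) (S : set 'cV[R]_N) : R :=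
  inf [set enorm s | s in S].

Definition cvx_fun (R : realType) (N : nat) (h : 'cV[R]_N -> R) : Prop :=
  forall (u w : 'cV[R]_N) (t : R), 0 <= t <= 1 ->
    h (t *: u + (1 - t) *: w) <= t * h u + (1 - t) * h w.
Definition cvx_set (R : realType) (N : nat) (S : set 'cV[R]_N) : Prop :=
  forall (u w : 'cV[R]_N) (t : R), S u -> S w -> 0 <= t <= 1 ->
    S (t *: u + (1 - t) *: w).
(* a real-valued (hence proper) function is closed iff it is lower semicontinuous *)
Definition closed_fun (R : realType) (N : nat) (h : 'cV[R]_N -> R) : Prop :=
  lower_semicontinuous (fun u : 'cV[R]_N => (h u)%:E).
(* subgrad h D u v  <->  v \in \partial (h + \delta_D)(u)  (convex subdifferential) *)
Definition subgrad (R : realType) (N : nat) (h : 'cV[R]_N -> R) (D : set 'cV[R]_N)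
    (u v : 'cV[R]_N) : Prop :=
  D u /\ forall w, D w -> h u + inner v (w - u) <= h w.

Definition inK (R : realType) (p q : nat) (u : 'cV[R]_(p + q)) : Prop :=
  usubmx u = 0 /\ forall j, dsubmx u j 0 <= 0.
Definition inKpol (R : realType) (p q : nat) (u : 'cV[R]_(p + q)) : Prop :=
  forall j, 0 <= dsubmx u j 0.
Definition projKpol (R : realType) (p q : nat) (u : 'cV[R]_(p + q)) : 'cV[R]_(p + q) :=
  col_mx (usubmx u) (map_mx (fun a => Num.max a 0) (dsubmx u)).

Definition Gfun (R : realType) (p q ni : nat) (Ai : 'M[R]_(p, ni)) (bi : 'cV[R]_p)
    (gi : 'cV[R]_ni -> 'cV[R]_q) (u : 'cV[R]_ni) : 'cV[R]_(p + q) :=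
  col_mx (Ai *m u - bi) (gi u).

Definition kronI (R : realType) (s a b : nat) (P : 'M[R]_(a, b))
  : 'M[R]_(\sum_(i < a) s, \sum_(j < b) s) :=
  @mxblock R a b (fun _ => s) (fun _ => s) (fun i j => (P i j)%:M).
Definition lambda_max (R : realType) (m : nat) (P : 'M[R]_m) : R :=
  sup [set a | eigenvalue P a].

Definition bdiag (R : realType) (m : nat) (s : 'I_m -> nat) (c : 'I_m -> R)
  : 'M[R]_(\sum_(i < m) s i) := \mxdiag_(i < m) ((c i)%:M : 'M[R]_(s i)).

Section BigMatrices.
Definition Qmat (R : realType) (m r : nat) (n : 'I_m -> nat) (s : nat)
    (alpha gamma : 'I_m -> R) (beta : R) (U : 'M[R]_(r, m))
  : 'M[R]_((\sum_(i < m) n i + \sum_(i < m) s) + \sum_(j < r) s) :=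
  block_mx (block_mx (invmx (bdiag n alpha)) 0 0 (invmx (bdiag (fun _ => s) gamma)))
           (col_mx 0 (- (kronI s U)^T))
           0 (beta^-1)%:M.
Definition Mmat (R : realType) (m r : nat) (n : 'I_m -> nat) (s : nat)
    (theta gamma : 'I_m -> R) (U : 'M[R]_(r, m))
  : 'M[R]_((\sum_(i < m) n i + \sum_(i < m) s) + \sum_(j < r) s) :=
  block_mx (block_mx (bdiag n theta) 0 0 1%:M)
           (col_mx 0 (- (bdiag (fun _ => s) gamma *m (kronI s U)^T)))
           0 1%:M.
Definition Hmat (R : realType) (m r : nat) (n : 'I_m -> nat) (s : nat)
    (theta alpha gamma : 'I_m -> R) (beta : R) (U : 'M[R]_(r, m)) :=
  Qmat n s alpha gamma beta U *m invmx (Mmat n s theta gamma U).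
Definition Dmat (R : realType) (m r : nat) (n : 'I_m -> nat) (s : nat)
    (theta alpha gamma : 'I_m -> R) (beta : R) (U : 'M[R]_(r, m)) :=
  (Qmat n s alpha gamma beta U)^T + Qmat n s alpha gamma beta U
  - (Mmat n s theta gamma U)^T *m Hmat n s theta alpha gamma beta U
      *m Mmat n s theta gamma U.
End BigMatrices.

Definition stack (R : realType) (m : nat) (s : 'I_m -> nat) (u : forall i, 'cV[R]_(s i))
  : 'cV[R]_(\sum_(i < m) s i) := \mxcol_(i < m) u i.

(* \partial_x L(x,Y): L(.,Y) = sum_i f_i(x_i) + y_i^T G_i(x_i) + delta_{Omega_i}(x_i)
   - delta_{K°}(y_i); this is a finite-valued-on-prod(Omega_i) convex function of x
   when every y_i \in K° (and identically -oo otherwise, where we take the set empty). *)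
Definition dxL (R : realType) (m p q : nat) (n : 'I_m -> nat)
    (f : forall i, 'cV[R]_(n i) -> R) (A : forall i, 'M[R]_(p, n i))
    (b : 'I_m -> 'cV[R]_p) (g : forall i, 'cV[R]_(n i) -> 'cV[R]_q)
    (Om : forall i, set 'cV[R]_(n i))
    (x : forall i, 'cV[R]_(n i)) (Y : 'I_m -> 'cV[R]_(p + q))
  : set 'cV[R]_(\sum_(i < m) n i) :=
  [set w | (forall i, inKpol (Y i)) /\
     subgrad (fun X : 'cV[R]_(\sum_(i < m) n i) =>
                \sum_(i < m) (f i (submxcol X i)
                              + inner (Y i) (Gfun (A i) (b i) (g i) (submxcol X i))))
             (fun X => forall i, Om i (submxcol X i))
             (stack x) w].

(* \partial_Y [-L](x,Y): -L(x,.) = sum_i -f_i(x_i) - y_i^T G_i(x_i) - delta_{Omega_i}(x_i)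
   + delta_{K°}(y_i), a convex function of Y, finite on (K°)^m when every x_i \in Omega_i
   (identically -oo otherwise, where we take the set empty). *)
Definition dYnegL (R : realType) (m p q : nat) (n : 'I_m -> nat)
    (f : forall i, 'cV[R]_(n i) -> R) (A : forall i, 'M[R]_(p, n i))
    (b : 'I_m -> 'cV[R]_p) (g : forall i, 'cV[R]_(n i) -> 'cV[R]_q)
    (Om : forall i, set 'cV[R]_(n i))
    (x : forall i, 'cV[R]_(n i)) (Y : 'I_m -> 'cV[R]_(p + q))
  : set 'cV[R]_(\sum_(i < m) (p + q)) :=
  [set u | (forall i, Om i (x i)) /\
     subgrad (fun W : 'cV[R]_(\sum_(i < m) (p + q)) =>
                \sum_(i < m) (- f i (x i)
                              - inner (submxcol W i) (Gfun (A i) (b i) (g i) (x i))))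
             (fun W => forall i, inKpol (submxcol W i))
             (stack Y) u].

Definition dYL (R : realType) (m p q : nat) (n : 'I_m -> nat)
    (f : forall i, 'cV[R]_(n i) -> R) (A : forall i, 'M[R]_(p, n i))
    (b : 'I_m -> 'cV[R]_p) (g : forall i, 'cV[R]_(n i) -> 'cV[R]_q)
    (Om : forall i, set 'cV[R]_(n i))
    (x : forall i, 'cV[R]_(n i)) (Y : 'I_m -> 'cV[R]_(p + q))
  : set 'cV[R]_(\sum_(i < m) (p + q)) :=
  [set - u | u in dYnegL f A b g Om x Y].

Definition PhiSet (R : realType) (m r p q : nat) (n : 'I_m -> nat)
    (f : forall i, 'cV[R]_(n i) -> R) (A : forall i, 'M[R]_(p, n i))
    (b : 'I_m -> 'cV[R]_p) (g : forall i, 'cV[R]_(n i) -> 'cV[R]_q)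
    (Om : forall i, set 'cV[R]_(n i)) (U : 'M[R]_(r, m))
    (x : forall i, 'cV[R]_(n i)) (Y : 'I_m -> 'cV[R]_(p + q))
    (Z : 'cV[R]_(\sum_(j < r) (p + q)))
  : set 'cV[R]_((\sum_(i < m) n i + \sum_(i < m) (p + q)) + \sum_(j < r) (p + q)) :=
  [set s | exists w1 w2, dxL f A b g Om x Y w1 /\ dYL f A b g Om x Y w2 /\
     s = col_mx (col_mx w1 (- w2 + (kronI (p + q) U)^T *m Z))
                (- (kronI (p + q) U *m stack Y))].

(* phi_i^k(x_i, y_i) restricted to Omega_i (the indicator is handled by subgrad) *)
Definition phik (R : realType) (p q ni : nat) (fi : 'cV[R]_ni -> R)
    (Ai : 'M[R]_(p, ni)) (bi : 'cV[R]_p) (gi : 'cV[R]_ni -> 'cV[R]_q)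
    (alphai gammai : R) (xik : 'cV[R]_ni) (yi : 'cV[R]_(p + q)) (u : 'cV[R]_ni) : R :=
  fi u + (2 * gammai)^-1 * (sqnorm (projKpol (yi + gammai *: Gfun Ai bi gi u))
                            - sqnorm yi)
  + (2 * alphai)^-1 * sqnorm (u - xik).

Definition inexact_DPMM (R : realType) (m r p q : nat) (n : 'I_m -> nat)
    (f : forall i, 'cV[R]_(n i) -> R) (A : forall i, 'M[R]_(p, n i))
    (b : 'I_m -> 'cV[R]_p) (g : forall i, 'cV[R]_(n i) -> 'cV[R]_q)
    (Om : forall i, set 'cV[R]_(n i)) (L : 'M[R]_m) (U : 'M[R]_(r, m))
    (theta alpha gamma : 'I_m -> R) (beta : R) (eps : nat -> 'I_m -> R)
    (x xh v : nat -> forall i, 'cV[R]_(n i))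
    (y yh lam : nat -> 'I_m -> 'cV[R]_(p + q))
    (Z Zh : nat -> 'cV[R]_(\sum_(j < r) (p + q))) : Prop :=
  (forall i, Om i (x 0%N i)) /\ (forall i, inKpol (y 0%N i)) /\ (forall i, lam 0%N i = 0) /\
  forall k : nat,
    (forall i, 0 <= eps k i) /\
    (forall i, subgrad (phik (f i) (A i) (b i) (g i) (alpha i) (gamma i) (x k i)
                             (y k i - gamma i *: lam k i))
                       (Om i) (xh k i) (v k i)) /\
    (forall i, enorm (v k i) <= eps k i) /\
    (forall i, yh k i = projKpol (y k i - gamma i *: lam k i
                                  + gamma i *: Gfun (A i) (b i) (g i) (xh k i))) /\
    (forall i, x k.+1 i = (1 - theta i) *: x k i + theta i *: xh k i) /\
    (forall i, lam k.+1 i = lam k i + beta *: \sum_(j < m) L i j *: yh k j) /\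
    (forall i, y k.+1 i = yh k i + gamma i *: (lam k i - lam k.+1 i)) /\
    (* Z^k, Zhat^k : the (unique) vectors with Lambda^k = U^T Z^k, Lambda^{k+1} = U^T Zhat^k *)
    stack (lam k) = (kronI (p + q) U)^T *m Z k /\
    stack (lam k.+1) = (kronI (p + q) U)^T *m Zh k.

Definition xi_of (R : realType) (m r p q : nat) (n : 'I_m -> nat)
    (x : forall i, 'cV[R]_(n i)) (Y : 'I_m -> 'cV[R]_(p + q))
    (Z : 'cV[R]_(\sum_(j < r) (p + q)))
  : 'cV[R]_((\sum_(i < m) n i + \sum_(i < m) (p + q)) + \sum_(j < r) (p + q)) :=
  col_mx (col_mx (stack x) (stack Y)) Z.

Definition feasible (R : realType) (m p q : nat) (n : 'I_m -> nat)
    (A : forall i, 'M[R]_(p, n i)) (b : 'I_m -> 'cV[R]_p)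
    (g : forall i, 'cV[R]_(n i) -> 'cV[R]_q) (Om : forall i, set 'cV[R]_(n i))
    (x : forall i, 'cV[R]_(n i)) : Prop :=
  inK (\sum_(i < m) Gfun (A i) (b i) (g i) (x i)) /\ forall i, Om i (x i).

Definition has_optimal_solution (R : realType) (m p q : nat) (n : 'I_m -> nat)
    (f : forall i, 'cV[R]_(n i) -> R) (A : forall i, 'M[R]_(p, n i))
    (b : 'I_m -> 'cV[R]_p) (g : forall i, 'cV[R]_(n i) -> 'cV[R]_q)
    (Om : forall i, set 'cV[R]_(n i)) : Prop :=
  exists xs : forall i, 'cV[R]_(n i), feasible A b g Om xs /\
    forall x' : forall i, 'cV[R]_(n i), feasible A b g Om x' ->
      \sum_(i < m) f i (xs i) <= \sum_(i < m) f i (x' i).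

Definition bigO_geom (R : realType) (u : nat -> R) (t : R) : Prop :=
  exists C : R, exists K : nat, forall k, (K <= k)%N -> `|u k| <= C * t ^+ k.
Definition o_inv_plus_O_geom (R : realType) (u : nat -> R) (t : R) : Prop :=
  exists a c : nat -> R, (forall k, u k = a k + c k) /\
    ((fun k : nat => k%:R * a k) @ \oo --> (0 : R)) /\ bigO_geom c t.

(* Main.v *)
Require Import Defs.
From HB Require Import structures.
From mathcomp Require Import all_boot all_order all_algebra.
From mathcomp Require Import all_classical all_reals all_analysis.
From mathcomp Require Import ring lra zify.
Import Order.TTheory GRing.Theory Num.Theory.
Import numFieldNormedType.Exports.
Local Open Scope classical_set_scope.
Local Open Scope ring_scope.
Set Implicit Arguments. Unset Strict Implicit. Unset Printing Implicit Defensive.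

                                                                                              
                                                                       
                                                                                                 
                                                                                           
                                                                
                                                                                  
                                                                                     
                                                                                        
                                                                                         
                                                                                
                                                                                               
                                                                                              
                                                                                              
                                                                         

(** The algorithm is a prediction-correction method for finding a zero of [PhiSet]. The inexact
    proximal step and the projection say that [Q *m (xi k - xih k) + V k] belongs to [PhiSet] at
    [xih k] ([dpmm_prediction]), and the updates say that [xi k.+1 = xi k - M *m (xi k - xih k)]
    ([dpmm_correction]). The operator is monotone, being the sum of a convex-concave part and a skew
    coupling through [U] ([PhiSet_monotone]). Because [H *m M = Q] and [D] is the matching quadratic
    remainder, expanding a square in the [H]-form turns each monotonicity inequality into an energy
    inequality. For two consecutive predictions this gives the first claim
    ([prediction_monotone_step]).

    For the rates, monotonicity is used between a prediction and a zero of the operator, which gives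
    a quasi-Fejer inequality ([fejer_step]). [H] and [D] are coercive ([Hmat_coercive],
    [Dmat_coercive]), the latter thanks to the bound on [gamma i * beta]. With geometric errors the
    iterates stay bounded and the [D]-norms of [xi k - xih k] are summable. So the residuals
    [wsqnorm H (M *m (xi k - xih k))] are summable and, by the first claim, nonincreasing up to a
    geometric error; such a sequence is o(1/k) ([quasi_nonincreasing_little_o]). The residual is the
    quantity in (a), and with the geometric bound on [V k] it controls the norm of the element of
    [PhiSet] above, hence (b).

    The zero comes from convex duality ([saddle_point_exists]): Slater's condition yields
    multipliers ([slater_multiplier]) through a finite-dimensional Hahn-Banach theorem
    ([sublinear_support]). The step-size condition enters through [rayleigh_le_lambda_max], which
    ties the largest eigenvalue to the quadratic form. *)

(** * Inner products, quadratic forms and the distance to a set *)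

Section InnerProduct.
Context {R : realType}.
Implicit Types N : nat.

Lemma innerE N (u v : 'cV[R]_N) : inner u v = \sum_i u i 0 * v i 0.
Proof. by rewrite /inner mxE; apply: eq_bigr => i _; rewrite mxE. Qed.

Lemma innerC N (u v : 'cV[R]_N) : inner u v = inner v u.
Proof. by rewrite !innerE; apply: eq_bigr => i _; rewrite mulrC. Qed.

Lemma innerDr N (u v w : 'cV[R]_N) : inner u (v + w) = inner u v + inner u w.
Proof. by rewrite /inner mulmxDr mxE. Qed.

Lemma innerDl N (u v w : 'cV[R]_N) : inner (v + w) u = inner v u + inner w u.
Proof. by rewrite innerC innerDr !(innerC u). Qed.

Lemma innerZr N (a : R) (u v : 'cV[R]_N) : inner u (a *: v) = a * inner u v.
Proof. by rewrite /inner -scalemxAr mxE. Qed.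

Lemma innerZl N (a : R) (u v : 'cV[R]_N) : inner (a *: u) v = a * inner u v.
Proof. by rewrite innerC innerZr innerC. Qed.

Lemma innerNr N (u v : 'cV[R]_N) : inner u (- v) = - inner u v.
Proof. by rewrite -scaleN1r innerZr mulN1r. Qed.

Lemma innerNl N (u v : 'cV[R]_N) : inner (- u) v = - inner u v.
Proof. by rewrite innerC innerNr innerC. Qed.

Lemma inner0r N (u : 'cV[R]_N) : inner u 0 = 0.
Proof. by rewrite /inner mulmx0 mxE. Qed.

Lemma inner0l N (u : 'cV[R]_N) : inner 0 u = 0.
Proof. by rewrite innerC inner0r. Qed.

Definition inner_lin := (@innerDl, @innerDr, @innerNl, @innerNr, @innerZl, @innerZr).

Lemma inner_sumr N (I : Type) (s : seq I) (P : pred I) (F : I -> 'cV[R]_N) u :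
  inner u (\sum_(i <- s | P i) F i) = \sum_(i <- s | P i) inner u (F i).
Proof.
by apply: (big_morph (inner u)) => [v w|]; [rewrite innerDr | rewrite inner0r].
Qed.

Lemma inner_mulmx {N N' : nat} (B : 'M[R]_(N, N')) u v :
  inner u (B *m v) = inner (B^T *m u) v.
Proof. by rewrite /inner trmx_mul trmxK mulmxA. Qed.

Lemma inner_col_mx (N N' : nat) (u u' : 'cV[R]_N) (v v' : 'cV[R]_N') :
  inner (col_mx u v) (col_mx u' v') = inner u u' + inner v v'.
Proof. by rewrite /inner tr_col_mx mul_row_col mxE. Qed.

Lemma inner_mxcol (m : nat) (s : 'I_m -> nat) (u v : forall i, 'cV[R]_(s i)) :
  inner (\mxcol_i u i) (\mxcol_i v i) = \sum_i inner (u i) (v i).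
Proof. by rewrite /inner tr_mxcol mul_mxrow_mxcol summxE. Qed.

Lemma sqnorm_ge0 N (u : 'cV[R]_N) : 0 <= sqnorm u.
Proof. by rewrite /sqnorm innerE sumr_ge0 // => i _; rewrite -expr2 sqr_ge0. Qed.

Lemma sqnorm_eq0 N (u : 'cV[R]_N) : sqnorm u = 0 -> u = 0.
Proof.
rewrite /sqnorm innerE => /eqP; rewrite psumr_eq0; last first.
  by move=> i _; rewrite -expr2 sqr_ge0.
move=> /allP h; apply/colP => i; rewrite !mxE.
by have := h i (mem_index_enum _); rewrite /= mulf_eq0 orbb => /eqP.
Qed.

Lemma enorm_sqr N (u : 'cV[R]_N) : enorm u ^+ 2 = sqnorm u.
Proof. by rewrite sqr_sqrtr // sqnorm_ge0. Qed.

Lemma inner_Young N (c : R) (u v : 'cV[R]_N) : 0 < c ->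
  2 * inner u v <= c * sqnorm u + c^-1 * sqnorm v.
Proof.
move=> c0; have := sqnorm_ge0 (c *: u - v).
rewrite /sqnorm !inner_lin (innerC v u) => h.
have -> : c * inner u u + c^-1 * inner v v =
   c^-1 * (c * (c * inner u u) + inner v v) by field; rewrite gt_eqF.
by rewrite -ler_pdivrMl ?invr_gt0 // invrK; lra.
Qed.

(** Young's inequality with weight [e]. The bound is linear in the error and affine in [sqnorm u],
    the shape needed by a recursion with factor [1 + e k]. *)
Lemma inner_le_small N (e : R) (u v : 'cV[R]_N) : 0 <= e -> sqnorm v <= e ^+ 2 ->
  2 * inner u v <= e * (sqnorm u + 1).
Proof.
rewrite le_eqVlt => /predU1P[<-|e0] hv.
  have -> : v = 0.
    by apply: sqnorm_eq0; apply/eqP; rewrite eq_le sqnorm_ge0 andbT; rewrite expr0n in hv.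
  by rewrite inner0r; lra.
apply: le_trans (inner_Young u v e0) _.
rewrite mulrDr lerD2l mulr1 ler_pdivrMl //; lra.
Qed.

Lemma sqnormD_le N (u v : 'cV[R]_N) : sqnorm (u + v) <= 2 * sqnorm u + 2 * sqnorm v.
Proof.
have := sqnorm_ge0 (u - v); rewrite /sqnorm !inner_lin (innerC v u); lra.
Qed.

Lemma sqnormB_le N (u v : 'cV[R]_N) : sqnorm (u - v) <= 2 * sqnorm u + 2 * sqnorm v.
Proof. by apply: le_trans (sqnormD_le _ _) _; rewrite /sqnorm !inner_lin; lra. Qed.

Lemma wsqnorm_bounded N (W : 'M[R]_N) :
  exists C, 0 <= C /\ forall u, wsqnorm W u <= C * sqnorm u.
Proof.
exists (\sum_i \sum_j `|W i j|); split; first by do 2!apply: sumr_ge0 => ? _.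
move=> u; rewrite /wsqnorm innerE mulr_suml; apply: ler_sum => i _.
rewrite mxE mulr_sumr mulr_suml; apply: ler_sum => j _.
have hc (k : 'I_N) : u k 0 ^+ 2 <= sqnorm u.
  rewrite /sqnorm innerE (bigD1 k) //= -expr2 lerDl.
  by apply: sumr_ge0 => l _; rewrite -expr2 sqr_ge0.
rewrite mulrCA; apply: le_trans (ler_norm _) _.
rewrite normrM ler_wpM2l // ler_norml.
have hp := sqr_ge0 (u i 0 + u j 0); have hm := sqr_ge0 (u i 0 - u j 0).
by move: (hc i) (hc j) => *; apply/andP; split; nra.
Qed.

Lemma sqnorm_mulmx_bounded (N N' : nat) (B : 'M[R]_(N, N')) :
  exists C, 0 <= C /\ forall u, sqnorm (B *m u) <= C * sqnorm u.
Proof.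
have [C [C0 hC]] := wsqnorm_bounded (B^T *m B).
exists C; split=> // u; apply: le_trans (hC u).
by rewrite /wsqnorm -mulmxA (inner_mulmx B^T) trmxK.
Qed.

                                                                                          
(** If [W] is bounded by [C], nonnegativity of the form at [u - c *: (W *m u)] with [c = (C + 1)^-1]
    leaves [c * sqnorm (W *m u) <= wsqnorm W u]. *)
Lemma psd_sqnorm_mulmx N (W : 'M[R]_N) : W^T = W -> (forall u, 0 <= wsqnorm W u) ->
  exists C, 0 < C /\ forall u, sqnorm (W *m u) <= C * wsqnorm W u.
Proof.
move=> Wsym Wpsd; have [C [C0 hC]] := wsqnorm_bounded W.
exists (C + 1); split; first lra.
move=> u; have C1 : 0 < C + 1 by lra.
have := Wpsd (u - (C + 1)^-1 *: (W *m u)); have := hC (W *m u).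
rewrite /wsqnorm mulmxBr -scalemxAr !inner_lin.
rewrite (inner_mulmx W u (W *m u)) Wsym -!/(sqnorm _).
set a := inner _ (W *m (W *m u)); set b := inner u _; set s := sqnorm _.
move=> ha hb; have s0 : 0 <= s := sqnorm_ge0 _.
have hi : (C + 1)^-1 * (C + 1) = 1 by rewrite mulVf // gt_eqF.
set c := (C + 1)^-1 in hb hi *; have c0 : 0 < c by rewrite invr_gt0.
have hca : c * a <= s by nra.
have : c * (c * a) <= c * s by rewrite ler_pM2l.
move=> h2; have : c * s <= b by lra.
by move=> h3; nra.
Qed.

Lemma coercive_psd N (W : 'M[R]_N) (C : R) : 0 < C ->
  (forall u, sqnorm u <= C * wsqnorm W u) -> forall u, 0 <= wsqnorm W u.
Proof. by move=> C0 h u; rewrite -(pmulr_rge0 _ C0); exact: le_trans (sqnorm_ge0 u) (h u). Qed.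

Lemma dist0_ge0 N (S : set 'cV[R]_N) s : S s -> 0 <= dist0 S.
Proof.
by move=> Ss; apply: lb_le_inf; [exists (enorm s), s | move=> _ [w _ <-]; exact: sqrtr_ge0].
Qed.

Lemma sqr_dist0_le N (S : set 'cV[R]_N) s : S s -> dist0 S ^+ 2 <= sqnorm s.
Proof.
move=> Ss; rewrite -enorm_sqr lerXn2r ?nnegrE ?sqrtr_ge0 ?(dist0_ge0 Ss) //.
by apply: ge_inf; [exists 0 => _ [w _ <-]; exact: sqrtr_ge0 | exists s].
Qed.

End InnerProduct.

(** * Perturbed monotone sequences and o(1/k) rates *)

Section RealSequences.
Context {R : realType}.
Implicit Types u w e : nat -> R.

(** The finitely many early indices are absorbed by adding their ratios [|u k| / t' ^+ k] to the
    constant. This brings all agents to one common rate, valid from index 0. *)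
Lemma bigO_geom_all u (t t' : R) : 0 < t <= t' -> bigO_geom u t ->
  exists C, 0 <= C /\ forall k, `|u k| <= C * t' ^+ k.
Proof.
move=> /andP[t0 tt'] [C [K hC]]; have t'0 : 0 < t' by exact: lt_le_trans tt'.
exists (`|C| + \sum_(k < K) `|u k| / t' ^+ k).
have s0 : 0 <= \sum_(k < K) `|u k| / t' ^+ k.
  by apply: sumr_ge0 => k _; rewrite divr_ge0 // exprn_ge0 // ltW.
split; first by rewrite addr_ge0.
move=> k; have [Kk|kK] := leqP K k.
  apply: le_trans (hC k Kk) _; apply: le_trans (_ : `|C| * t' ^+ k <= _).
    apply: le_trans (ler_norm _) _; rewrite normrM ler_wpM2l //.
    by rewrite ger0_norm ?exprn_ge0 // ?(ltW t0) // lerXn2r // nnegrE ltW.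
  by rewrite ler_wpM2r ?lerDl // exprn_ge0 // ltW.
rewrite -ler_pdivrMr ?exprn_gt0 //; apply: le_trans (_ : \sum_(k < K) `|u k| / t' ^+ k <= _).
  rewrite (bigD1 (Ordinal kK)) //= lerDl; apply: sumr_ge0 => j _.
  by rewrite divr_ge0 // exprn_ge0 // ltW.
by rewrite lerDr.
Qed.

Lemma geom_sum_le (t : R) (k : nat) : 0 <= t < 1 ->
  \sum_(0 <= j < k) t ^+ j <= (1 - t)^-1.
Proof.
move=> /andP[t0 t1]; rewrite big_mkord.
have h : 0 < 1 - t by lra.
rewrite -(ler_pM2l h) mulfV ?gt_eqF // -[_ * _]opprK -mulNr opprB -subrX1 opprB.
by rewrite gerBl exprn_ge0.
Qed.

                                                                        
(** Since [1 + e k <= expR (e k)], the recursion gives [u k <= expR S * u 0]. Inserting this uniform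
    bound in the term [e k * u k] makes the recursion telescope and bounds the sums of [w]. *)
Lemma quasi_fejer_bounded u w e (S : R) :
  (forall k, 0 <= u k) -> (forall k, 0 <= w k) -> (forall k, 0 <= e k) ->
  (forall k, \sum_(0 <= j < k) e j <= S) ->
  (forall k, u k.+1 <= (1 + e k) * u k - w k) ->
  exists B, (forall k, u k <= B) /\ (forall k, \sum_(0 <= j < k) w j <= B).
Proof.
move=> u0 w0 e0 hS hu.
have hexp k : u k <= expR (\sum_(0 <= j < k) e j) * u 0%N.
  elim: k => [|k IH]; first by rewrite big_nil expR0 mul1r.
  rewrite big_nat_recr //= expRD mulrAC; apply: le_trans (hu k) _.
  have h1 := expR_ge1Dx (e k); move: (w0 k) (e0 k) (u0 k) => *.
  apply: le_trans (_ : (1 + e k) * u k <= _); first lra.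
  by rewrite mulrC ler_pM // addr_ge0.
pose B0 := expR S * u 0%N.
have hB k : u k <= B0.
  by apply: le_trans (hexp k) _; rewrite ler_wpM2r // ler_expR.
have B00 : 0 <= B0 by apply: le_trans (hB 0%N).
have hs k : u k + \sum_(0 <= j < k) w j <= u 0%N + B0 * \sum_(0 <= j < k) e j.
  elim: k => [|k IH]; first by rewrite !big_nil mulr0.
  rewrite !big_nat_recr //=; move: (hu k) (hB k) (e0 k) (u0 k) => *; nra.
have S0 : 0 <= S by have := hS 0%N; rewrite big_nil.
exists (u 0%N + B0 + B0 * S); split=> k.
  by apply: le_trans (hB k) _; move: (u0 0%N) (mulr_ge0 B00 S0) => *; lra.
have := hs k; have := hS k; move: (u0 k) => h1 h2 h3.
have : B0 * \sum_(0 <= j < k) e j <= B0 * S by rewrite ler_wpM2l.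
lra.
Qed.

(** By monotonicity [(k - N) * u k] is at most the sum of [u] from [N] to [k], a small Cauchy block,
    and [k <= 2 * (k - N)] once [k >= 2 * N]. *)
Lemma nonincreasing_summable_little_o u (S : R) :
  (forall k, 0 <= u k) -> (forall k, u k.+1 <= u k) ->
  (forall k, \sum_(0 <= j < k) u j <= S) ->
  (fun k : nat => k%:R * u k) @ \oo --> (0 : R).
Proof.
move=> u0 ui hS.
have umon j k : (j <= k)%N -> u k <= u j.
  by move=> jk; apply: (@nonincreasing_seqP _ R u).1.
have cs : cvgn (fun k => \sum_(0 <= j < k) u j).
  apply: nondecreasing_is_cvgn.
    apply/nondecreasing_seqP => k; by rewrite big_nat_recr //= lerDl.
  by exists S => _ [k _ <-].
apply/cvgrPdist_lt => eps eps0.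
have /cvg_cauchy /cauchy_seriesP := cs.
move=> /(_ (eps / 2)); rewrite divr_gt0 // => /(_ isT) [[P1 P2] /= [[N1 _ hN1] [N2 _ hN2]] hP].
pose N := maxn N1 N2.
exists (2 * N)%N => //= k /= kN; rewrite sub0r normrN.
have kN' : (N <= k)%N by apply: leq_trans kN; rewrite leq_pmull.
have := hP (N, k); rewrite /= => /(_ _)/wrap[].
  by split; [apply: hN1; exact: leq_maxl | apply: hN2; apply: leq_trans kN'; exact: leq_maxr].
rewrite ger0_norm ?sumr_ge0 // => hk.
rewrite ger0_norm ?mulr_ge0 //.
have h1 : (k - N)%:R * u k <= \sum_(N <= j < k) u j.
  rewrite mulr_natl -(sumr_const_nat k N (u k)); apply: ler_sum_nat => j /andP[_ jk].
  by apply: umon; exact: ltnW.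
apply: le_lt_trans (_ : 2 * ((k - N)%:R * u k) < eps).
  rewrite mulrA ler_wpM2r // -natrM ler_nat mulnBr; lia.
lra.
Qed.

Lemma natr_geom_cvg0 (t : R) : 0 <= t < 1 -> (fun k : nat => k%:R * t ^+ k) @ \oo --> (0 : R).
Proof.
move=> /andP[t0 t1]; apply: (@nonincreasing_summable_little_o _ (1 - t)^-1).
- by move=> k; exact: exprn_ge0.
- by move=> k; rewrite exprS; move: (exprn_ge0 k t0) => *; nra.
- by move=> k; apply: geom_sum_le; rewrite t0.
Qed.

(** Adding [c * t ^+ k] with [c = C / (1 - t)] makes the sequence nonincreasing, because
    [c * t ^+ k - c * t ^+ k.+1 = C * t ^+ k]; it stays summable. *)
Lemma quasi_nonincreasing_little_o u (S C t : R) : 0 <= t < 1 -> 0 <= C ->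
  (forall k, 0 <= u k) -> (forall k, u k.+1 <= u k + C * t ^+ k) ->
  (forall k, \sum_(0 <= j < k) u j <= S) ->
  (fun k : nat => k%:R * u k) @ \oo --> (0 : R).
Proof.
move=> /andP[t0 t1] C0 u0 ui hS.
pose c := C / (1 - t).
have h : 0 < 1 - t by lra.
have c0 : 0 <= c by rewrite divr_ge0 // ltW.
have hc : C = c * (1 - t) by rewrite divfK // gt_eqF.
apply: (@squeeze_cvgr _ _ _ _ (fun=> 0) (fun k => k%:R * (u k + c * t ^+ k))).
- near=> k; rewrite mulr_ge0 //= ler_wpM2l // lerDl mulr_ge0 // exprn_ge0 //.
- exact: cvg_cst.
apply: (@nonincreasing_summable_little_o _ (S + c * (1 - t)^-1)).
- by move=> k; rewrite addr_ge0 // mulr_ge0 // exprn_ge0.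
- move=> k; have := ui k; rewrite hc exprS; move: (exprn_ge0 k t0) => *; nra.
- move=> k; rewrite big_split /= -mulr_sumr lerD // ler_wpM2l // geom_sum_le //.
  by rewrite t0.
Unshelve. all: by end_near. Qed.

Lemma natr_mul_cvg0_le u a c (A B : R) :
  (forall k, 0 <= u k <= A * a k + B * c k) ->
  (fun k : nat => k%:R * a k) @ \oo --> (0 : R) ->
  (fun k : nat => k%:R * c k) @ \oo --> (0 : R) ->
  (fun k : nat => k%:R * u k) @ \oo --> (0 : R).
Proof.
move=> hu ha hc.
apply: (@squeeze_cvgr _ _ _ _ (fun=> 0)
  (fun k => A * (k%:R * a k) + B * (k%:R * c k))).
- near=> k; have /andP[u0 ule] := hu k; rewrite mulr_ge0 //=.
  by rewrite !(mulrCA _ k%:R) -mulrDr ler_wpM2l.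
- exact: cvg_cst.
have -> : (0 : R) = A * 0 + B * 0 by rewrite !mulr0 addr0.
by apply: cvgD; apply: cvgM => //; exact: cvg_cst.
Unshelve. all: by end_near. Qed.

Lemma sum_sqr_le (m : nat) (a : 'I_m -> R) : (forall i, 0 <= a i) ->
  \sum_i a i ^+ 2 <= (\sum_i a i) ^+ 2.
Proof.
move=> a0; rewrite [leRHS]expr2 mulr_suml; apply: ler_sum => i _.
rewrite expr2 ler_wpM2l // (bigD1 i) //= lerDl; exact: sumr_ge0.
Qed.

(** A geometric sequence is itself o(1/k), so each final bound is placed whole in the first
    summand. *)
Lemma little_o_plus_O_geom u (t : R) : (fun k : nat => k%:R * u k) @ \oo --> (0 : R) ->
  o_inv_plus_O_geom u t.
Proof.
move=> hu; exists u, (fun=> 0); split=> [k|]; first by rewrite addr0.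
by split=> //; exists 0, 0%N => k _; rewrite normr0 mul0r.
Qed.

End RealSequences.

(** * Hahn-Banach for sublinear functionals on a finite-dimensional space *)

Section HahnBanach.
Context {R : realType} {N : nat}.
Implicit Types (p : 'cV[R]_N -> R) (u v d : 'cV[R]_N).

(** Homogeneity is asked as an inequality; applying it with [a^-1] gives the reverse one. *)
Definition sublinear p :=
  (forall (a : R) u, 0 < a -> p (a *: u) <= a * p u) /\
  (forall u v, p (u + v) <= p u + p v).

Lemma sublinear0 p : sublinear p -> p 0 = 0.
Proof.
move=> [ph pa].
have h1 := ph 2 0 ltac:(lra); rewrite scaler0 in h1.
have h2 := ph 2^-1 0 ltac:(lra); rewrite scaler0 in h2.
by apply/eqP; rewrite eq_le; apply/andP; split; lra.
Qed.

                                                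
(** The functional is the infimum over [t >= 0] of [p (d + t *: v) - t * p v], finite because
    [- p (- d)] is a lower bound. The value [t = 0] gives [p' v <= p v], and [t = 1] gives
    [p' (- v) <= - p v]. *)
Lemma sublinear_straighten p v : sublinear p ->
  exists p', [/\ sublinear p', forall d, p' d <= p d & p' v + p' (- v) <= 0].
Proof.
move=> sp; have p0 := sublinear0 sp; case: sp => ph pa.
pose E d := [set p (d + t *: v) - t * p v | t in [set t : R | 0 <= t]].
have Enz d : E d !=set0 by exists (p (d + 0 *: v) - 0 * p v), 0 => //=.
have Elb d : has_lbound (E d).
  exists (- p (- d)) => _ [t /= t0 <-].
  have h1 : p (t *: v) <= p (d + t *: v) + p (- d).
    by apply: le_trans (pa _ _); rewrite addrAC subrr add0r.
  have h2 : t * p v <= p (t *: v).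
    move: t0; rewrite le_eqVlt => /predU1P[<-|t0]; first by rewrite scale0r p0 mul0r.
    have ti : 0 < t^-1 by rewrite invr_gt0.
    have := ph t^-1 (t *: v) ti.
    by rewrite scalerA mulVf ?gt_eqF // scale1r -ler_pdivrMl // invrK.
  lra.
have Ele d t : 0 <= t -> inf (E d) <= p (d + t *: v) - t * p v.
  by move=> t0; apply: ge_inf => //; exists t.
exists (fun d => inf (E d)); split; first split.
- move=> a d a0 /=; rewrite -ler_pdivrMl //; apply: lb_le_inf => // _ [t /= t0 <-].
  rewrite ler_pdivrMl //; apply: le_trans (Ele _ (a * t) _) _.
    by rewrite mulr_ge0 // ltW.
  have := ph a (d + t *: v) a0; rewrite scalerDr scalerA mulrBr mulrA; lra.
- move=> d d' /=; rewrite -lerBlDr; apply: lb_le_inf => // _ [t /= t0 <-].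
  rewrite lerBlDr -lerBlDl; apply: lb_le_inf => // _ [s /= s0 <-].
  rewrite lerBlDl; apply: le_trans (Ele _ (t + s) _) _; first by rewrite addr_ge0.
  have := pa (d + t *: v) (d' + s *: v).
  by rewrite addrACA -scalerDl; lra.
- by move=> d; apply: le_trans (Ele d 0 (lexx _)) _; rewrite scale0r addr0 mul0r subr0.
- have h1 := Ele v 0 (lexx _); have h2 := Ele (- v) 1 ler01.
  by rewrite scale0r addr0 mul0r subr0 in h1; rewrite scale1r addNr p0 in h2; lra.
Qed.

(** Directions treated earlier stay straight, because passing to a smaller functional preserves
    [p' v + p' (- v) <= 0]. *)
Lemma sublinear_straighten_seq p (s : seq 'cV[R]_N) : sublinear p ->
  exists p', [/\ sublinear p', forall d, p' d <= p d &
    forall v, v \in s -> p' v + p' (- v) <= 0].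
Proof.
move=> sp; elim: s => [|v s [p' [sp' p'p hp']]]; first by exists p; split.
have [p2 [sp2 p2p' hp2]] := sublinear_straighten v sp'.
exists p2; split=> //; first by move=> d; exact: le_trans (p2p' d) (p'p d).
move=> w; rewrite inE => /predU1P[->//|/hp' h].
by apply: le_trans h; apply: lerD.
Qed.

(** Once straight along the basis vectors, [p'] is linear, and its coordinates are its values
    there. *)
Lemma sublinear_support p : sublinear p -> exists c, forall d, inner c d <= p d.
Proof.
move=> sp.
have [p' [sp' p'p hp']] :=
  sublinear_straighten_seq [seq delta_mx i 0 | i <- enum 'I_N] sp.
have p'0 := sublinear0 sp'; case: sp' => ph pa.
pose c : 'cV[R]_N := \col_i p' (delta_mx i 0); exists c.
have hc d : p' d <= inner c d.
  have -> : d = \sum_i d i 0 *: delta_mx i (0 : 'I_1).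
    by rewrite {1}[d]matrix_sum_delta; apply: eq_bigr => i _; rewrite big_ord1.
  rewrite inner_sumr; apply: (big_ind2 (fun u a => p' u <= a)); first by rewrite p'0.
    by move=> u a v b hu hv; apply: le_trans (pa _ _) _; exact: lerD.
  move=> i _; rewrite innerZr.
  have -> : inner c (delta_mx i 0) = p' (delta_mx i 0).
    rewrite innerE (bigD1 i) //= big1 => [|j ji]; last by rewrite !mxE (negbTE ji) mulr0.
    by rewrite !mxE !eqxx mulr1 addr0.
  have [di|di|->] := ltgtP (d i 0) 0; last by rewrite scale0r p'0 mul0r.
    have : - d i 0 > 0 by lra.
    move=> /(fun h => ph _ (- delta_mx i 0) h); rewrite scaleNr scalerN opprK.
    have hi : i \in enum 'I_N by rewrite mem_enum.
    have := hp' _ (map_f (fun i => delta_mx i 0) hi); nra.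
  exact: ph.
(* The bound [p' <= inner c] at [- d], with [0 = p' 0 <= p' d + p' (- d)], gives the opposite bound
   at [d]. *)
move=> d; apply: le_trans (p'p d).
have := pa d (- d); rewrite subrr p'0; have := hc (- d); rewrite innerNr; lra.
Qed.

(** [P] plays the part of a convex cone of pairs, and the infimum of each fibre is a sublinear
    functional. It is finite because an element over [- d] added to one over [d] dominates an
    element over [0]. *)
Lemma sublinear_relation_support (P : 'cV[R]_N -> R -> Prop) :
  (forall d, exists a, P d a) ->
  (forall d d' a a', P d a -> P d' a' -> exists2 a'', a'' <= a + a' & P (d + d') a'') ->
  (forall (c : R) d a, 0 < c -> P d a -> P (c *: d) (c * a)) ->
  (forall a, P 0 a -> 0 <= a) ->
  exists c, forall d a, P d a -> inner c d <= a.
Proof.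
move=> Pn Pa Ph P0; pose p d := inf [set a | P d a].
have Plb d : has_lbound [set a | P d a].
  have [a ha] := Pn (- d); exists (- a) => b /= hb.
  by have [c hc] := Pa _ _ _ _ hb ha; rewrite subrr => /P0; lra.
have ple d a : P d a -> p d <= a by move=> h; apply: ge_inf.
have pge d b : (forall a, P d a -> b <= a) -> b <= p d.
  by move=> h; apply: lb_le_inf => //; exact: Pn.
have [|c hc] := @sublinear_support p; last first.
  by exists c => d a /ple; exact: le_trans.
split=> [a d a0|d d'].
  rewrite -ler_pdivrMl //; apply: (pge) => b hb; rewrite ler_pdivrMl //.
  exact/ple/Ph.
rewrite -lerBlDr; apply: (pge) => a ha; rewrite lerBlDr -lerBlDl.
apply: (pge) => b hb; rewrite lerBlDl.
by have [e le_e /ple] := Pa _ _ _ _ ha hb; move=> h; apply: le_trans h _; lra.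
Qed.

End HahnBanach.

(** * Lagrange multipliers under Slater's condition *)

Section Multipliers.
Context {R : realType}.

(** The residual [w] of [c] against the cokernel has squared norm [inner c (cokermx A *m w)], and
    [cokermx A *m w] lies in the kernel of [A]. *)
Lemma orthogonal_ker_range (a b : nat) (A : 'M[R]_(a, b)) (c : 'cV[R]_b) :
  (forall h : 'cV_b, A *m h = 0 -> inner c h = 0) -> exists mu, c = A^T *m mu.
Proof.
move=> hc; have /submxP[D hD] : (c^T <= A)%MS.
  rewrite submxE; apply/eqP/trmx_inj; rewrite trmx0; apply: sqnorm_eq0.
  set w := (_ *m _)^T; rewrite /sqnorm {1}/w trmx_mul trmxK -inner_mulmx.
  by apply: hc; rewrite mulmxA mulmx_coker mul0mx.
by exists D^T; rewrite -[c]trmxK hD trmx_mul.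
Qed.

Lemma common_lower_bound (k : nat) (t : 'I_k -> R) : (forall i, 0 < t i) ->
  exists2 s, 0 < s <= 1 & forall i, s <= t i.
Proof.
move=> t0; pose S := \sum_i (t i)^-1.
have S0 : 0 <= S by apply: sumr_ge0 => i _; rewrite invr_ge0 ltW.
have S1 : 0 < 1 + S by lra.
exists (1 + S)^-1; first by rewrite invr_gt0 S1 invf_le1 // lerDl.
move=> i; rewrite -[leRHS]invrK lef_pV2 ?posrE ?invr_gt0 //.
rewrite /S (bigD1 i) //=.
have : 0 <= \sum_(j < k | j != i) (t j)^-1 by apply: sumr_ge0 => j _; rewrite invr_ge0 ltW.
lra.
Qed.

Lemma small_step (a e : R) : a < 0 ->
  exists2 s0, 0 < s0 <= 1 & forall s, 0 <= s <= s0 -> a + s * e <= 0.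
Proof.
move=> a0; pose s0 := - a / (- a + `|e|).
have d0 : 0 < - a + `|e| by have := normr_ge0 e; lra.
exists s0.
  by rewrite divr_gt0 //=; [rewrite ler_pdivrMr // mul1r lerDl | lra].
move=> s /andP[s1 s2].
have hs : s * (- a + `|e|) <= - a by rewrite -ler_pdivlMr.
have := ler_norm e; have := normr_ge0 e; nra.
Qed.

(** A linear functional supporting the scaled perturbation cone [P] is, up to sign, the pair of
    multipliers. The Slater point makes every fibre of [P] nonempty, and optimality makes the fibre
    over [0] nonnegative. *)
Lemma slater_multiplier (n p q : nat) (F : 'cV[R]_n -> R) (A : 'M[R]_(p, n)) (b : 'cV[R]_p)
    (g : 'cV[R]_n -> 'cV[R]_q) (Om : set 'cV[R]_n) (xs xb : 'cV[R]_n) :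
  cvx_fun F -> (forall j, cvx_fun (fun u => g u j 0)) -> cvx_set Om ->
  Om xs -> A *m xs = b -> (forall j, g xs j 0 <= 0) ->
  (forall x, Om x -> A *m x = b -> (forall j, g x j 0 <= 0) -> F xs <= F x) ->
  (forall h, exists2 t : R, 0 < t & Om (xb + t *: h)) ->
  A *m xb = b -> (forall j, g xb j 0 < 0) ->
  exists (mu : 'cV[R]_p) (nu : 'cV[R]_q), (forall j, 0 <= nu j 0) /\
    forall x, Om x -> F xs <= F x + inner mu (A *m x - b) + inner nu (g x).
Proof.
move=> Fc gc Oc Oxs Axs gxs opt Oxb Axb gxb.
(* [z] stacks a perturbation of each constraint and [a] is a difference quotient of [F]. The
   equality constraint is perturbed by [A *m h], so every [h] is attainable whatever the rank of
   [A]. *)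
pose P (z : 'cV[R]_(n + q)) (a : R) := exists (t : R) (x : 'cV[R]_n),
  [/\ 0 < t, Om x, A *m x - b = t *: (A *m usubmx z),
      forall j, g x j 0 <= t * dsubmx z j 0 & a = (F x - F xs) / t].
have [||||c hc] := @sublinear_relation_support R (n + q) P.
(* Moving from [xb] along the first half of [z], the strict inequality at [xb] outweighs the change
   of [g] and the second half of [z] for a small fraction [s] of [t0]. *)
- move=> z; have [t0 t00 Ot0] := Oxb (usubmx z).
  have hsm j := small_step (g (xb + t0 *: usubmx z) j 0 - g xb j 0 - t0 * dsubmx z j 0) (gxb j).
  have /choice[s0 hs0] j : exists s0, 0 < s0 <= 1 /\ forall s, 0 <= s <= s0 ->
      g xb j 0 + s * (g (xb + t0 *: usubmx z) j 0 - g xb j 0 - t0 * dsubmx z j 0) <= 0.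
    by have [s ? ?] := hsm j; exists s.
  have [j|s /andP[sp s1] hs] := @common_lower_bound q s0.
    by have [/andP[]] := hs0 j.
  have ex : xb + (s * t0) *: usubmx z = s *: (xb + t0 *: usubmx z) + (1 - s) *: xb.
    by apply/matrixP => i j; rewrite !mxE; ring.
  have Oxb0 : Om xb.
    by have [t _] := Oxb 0; rewrite scaler0 addr0.
  have s01 : 0 <= s <= 1 by rewrite s1 ltW.
  exists ((F (xb + (s * t0) *: usubmx z) - F xs) / (s * t0)), (s * t0), (xb + (s * t0) *: usubmx z).
  split=> //; first by rewrite mulr_gt0.
  + by rewrite ex; apply: Oc.
  + by rewrite mulmxDr Axb -scalemxAr addrAC subrr add0r.
  + move=> j; rewrite ex; apply: le_trans (gc j _ _ _ s01) _.
    have [_ /(_ s)] := hs0 j; rewrite hs (ltW sp) => /(_ isT); nra.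
- move=> z z' _ _ [t [x [t0 Ox Ax gx ->]]] [t' [x' [t'0 Ox' Ax' gx' ->]]].
  have tt : 0 < t + t' by lra.
  have ttn : t + t' != 0 by rewrite gt_eqF.
  (* The weight is chosen so that [l * t] and [(1 - l) * t'] both equal [t2]; the combined point
     then serves [z + z'] at scale [t2]. *)
  pose l := t' / (t + t').
  have l01 : 0 <= l <= 1.
    apply/andP; split; first by rewrite divr_ge0 // ltW.
    by rewrite ler_pdivrMr //; lra.
  have hl : 1 - l = t / (t + t') by rewrite /l; field.
  pose x2 := l *: x + (1 - l) *: x'.
  pose t2 := t * t' / (t + t').
  have t20 : 0 < t2 by rewrite !(mulr_gt0, invr_gt0).
  have e1 : l * t = t2 by rewrite /l /t2; field.
  have e2 : (1 - l) * t' = t2 by rewrite hl /t2; field.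
  exists ((F x2 - F xs) / t2).
    have := Fc x x' l l01; rewrite -/x2 => hF.
    rewrite ler_pdivrMr //; apply: le_trans (_ : l * (F x - F xs) + (1 - l) * (F x' - F xs) <= _).
      by lra.
    rewrite le_eqVlt; apply/predU1P; left.
    by rewrite hl /l /t2; field; rewrite ttn !gt_eqF.
  exists t2, x2; split=> //.
  + exact: Oc.
  + have -> : A *m x2 - b = l *: (A *m x - b) + (1 - l) *: (A *m x' - b).
      rewrite mulmxDr -!scalemxAr; move: (A *m x) (A *m x') => u u'.
      by apply/matrixP => i j; rewrite !mxE; ring.
    rewrite Ax Ax' !scalerA e1 e2 -scalerDr -mulmxDr; congr (_ *: (_ *m _)).
    by apply/matrixP => i j; rewrite !mxE.
  + move=> j; apply: le_trans (gc j _ _ _ l01) _.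
    have [l0 l1] := andP l01.
    have -> : dsubmx (z + z') j 0 = dsubmx z j 0 + dsubmx z' j 0 by rewrite !mxE.
    have := ler_wpM2l l0 (gx j).
    have := ler_wpM2l (_ : 0 <= 1 - l) (gx' j); rewrite subr_ge0 => /(_ l1).
    rewrite !mulrA e1 e2; lra.
- move=> c z _ c0 [t [x [t0 Ox Ax gx ->]]]; exists (t / c), x; split=> //.
  + by rewrite divr_gt0.
  + rewrite Ax; have -> : usubmx (c *: z) = c *: usubmx z by apply/matrixP => i j; rewrite !mxE.
    by rewrite -scalemxAr scalerA divfK // gt_eqF.
  + move=> j; have -> : dsubmx (c *: z) j 0 = c * dsubmx z j 0 by rewrite !mxE.
    by rewrite mulrA divfK ?gt_eqF.
  + by field; rewrite !gt_eqF.
- move=> _ [t [x [t0 Ox Ax gx ->]]]; apply: divr_ge0 (ltW t0); rewrite subr_ge0; apply: opt => //.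
    apply/eqP; rewrite -subr_eq0 Ax.
    have -> : usubmx (0 : 'cV[R]_(n + q)) = 0 by apply/matrixP => i j; rewrite !mxE.
    by rewrite mulmx0 scaler0.
  by move=> j; have := gx j; rewrite !mxE mulr0.
pose c1 := usubmx c; pose c2 := dsubmx c.
have hcc h d : inner c (col_mx h d) = inner c1 h + inner c2 d.
  by rewrite -[c]vsubmxK inner_col_mx.
have hP (h : 'cV[R]_n) (d : 'cV[R]_q) x :
    Om x -> A *m x - b = A *m h -> (forall j, g x j 0 <= d j 0) ->
    inner c1 h + inner c2 d <= F x - F xs.
  move=> Ox Ax gx; rewrite -hcc; apply: hc; exists 1, x; split; rewrite ?ltr01 //.
  - by rewrite col_mxKu scale1r.
  - by move=> j; rewrite col_mxKd mul1r.
  - by rewrite divr1.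
(* The test point is [xs], where the right side vanishes: raising one coordinate of [d] gives the
   sign of [c2], and moving along the kernel of [A] shows below that [c1] is orthogonal to it. *)
have c2le j : c2 j 0 <= 0.
  have := hP 0 (delta_mx j 0) xs Oxs _ _.
  rewrite Axs subrr mulmx0 inner0r add0r subrr => /(_ erefl)/(_ _)/wrap[].
    by move=> i; apply: le_trans (gxs i) _; rewrite mxE ler0n.
  rewrite innerE (bigD1 j) //= big1 => [|i ij]; last by rewrite !mxE (negbTE ij) mulr0.
  by rewrite !mxE !eqxx mulr1 addr0.
have hker h : A *m h = 0 -> inner c1 h <= 0.
  move=> Ah; have := hP h 0 xs Oxs _ _; rewrite Axs subrr Ah inner0r addr0 subrr => -> //.
  by move=> j; rewrite mxE.
have [h Ah|mu hmu] := @orthogonal_ker_range _ _ A c1.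
  apply/eqP; rewrite eq_le hker //=.
  have : inner c1 (- h) <= 0 by apply: hker; rewrite mulmxN Ah oppr0.
  by rewrite innerNr oppr_le0.
exists (- mu), (- c2); split; first by move=> j; rewrite mxE oppr_ge0.
(* Any [x] in [Om] is attained at scale 1 by the perturbation [(x - xb, g x)], because
   [A *m xb = b]. *)
move=> x Ox; have := hP (x - xb) (g x) x Ox _ (fun=> lexx _).
rewrite mulmxBr Axb => /(_ erefl); rewrite hmu -inner_mulmx mulmxBr Axb !innerNl; lra.
Qed.

End Multipliers.

(** * Rayleigh quotients and the largest eigenvalue *)

Section Rayleigh.
Context {R : realType}.

Lemma wsqnormE_sub (N : nat) (L : 'M[R]_N) (a : R) u :
  wsqnorm (a%:M - L) u = a * sqnorm u - wsqnorm L u.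
Proof. by rewrite /wsqnorm mulmxBl mul_scalar_mx !inner_lin. Qed.

                                                                                      
                                                                                        
(** The least [mu] dominating the form is an eigenvalue: otherwise [mu%:M - L] is positive
    semidefinite and invertible, hence coercive, and a number smaller than [mu] would still
    dominate. *)
Lemma rayleigh_le_lambda_max (m : nat) (L : 'M[R]_m) : L^T = L ->
  forall w, wsqnorm L w <= lambda_max L * sqnorm w.
Proof.
move=> Lsym w; have [w0|/eqP w0] := eqVneq (sqnorm w) 0.
  by rewrite (sqnorm_eq0 w0) /wsqnorm /sqnorm mulmx0 inner0r mulr0.
have wp : 0 < sqnorm w by rewrite lt_def sqnorm_ge0 andbT; apply/eqP.
pose E := [set c : R | forall u, wsqnorm L u <= c * sqnorm u].
have E0 : E !=set0 by have [C [_ hC]] := wsqnorm_bounded L; exists C.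
have Elb : has_lbound E.
  by exists (wsqnorm L w / sqnorm w) => c hc; rewrite ler_pdivrMr.
pose mu := inf E.
have hmu u : wsqnorm L u <= mu * sqnorm u.
  have [u0|/eqP u0] := eqVneq (sqnorm u) 0.
    by rewrite (sqnorm_eq0 u0) /wsqnorm /sqnorm mulmx0 inner0r mulr0.
  have up : 0 < sqnorm u by rewrite lt_def sqnorm_ge0 andbT; apply/eqP.
  by rewrite -ler_pdivrMr //; apply: lb_le_inf => // c hc; rewrite ler_pdivrMr.
have eig : eigenvalue L mu.
  rewrite /eigenvalue /eigenspace kermx_eq0 row_free_unit; apply/negP => Lu.
  have Ssym : (mu%:M - L)^T = mu%:M - L by rewrite linearB /= tr_scalar_mx Lsym.
  have [u|C [C0 hC]] := psd_sqnorm_mulmx Ssym.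
    by rewrite wsqnormE_sub subr_ge0.
  have [C' [C'0 hC']] := sqnorm_mulmx_bounded (invmx (L - mu%:M)).
  pose K := C' * C + 1.
  have K0 : 0 < K by have := mulr_ge0 C'0 (ltW C0); rewrite /K; lra.
  have : mu <= mu - K^-1.
    apply: ge_inf => // u; rewrite mulrBl lerBrDr -lerBrDl -wsqnormE_sub.
    rewrite ler_pdivrMl //.
    have := hC' ((L - mu%:M) *m u); rewrite mulKmx // => h1.
    have h2 := hC u.
    have hS : sqnorm ((mu%:M - L) *m u) = sqnorm ((L - mu%:M) *m u).
      by rewrite -opprB mulNmx /sqnorm !inner_lin opprK.
    rewrite -hS in h1.
    have h3 : 0 <= wsqnorm (mu%:M - L) u by rewrite wsqnormE_sub subr_ge0.
    have := ler_wpM2l C'0 h2; rewrite /K; nra.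
  have : 0 < K^-1 by rewrite invr_gt0.
  lra.
(* To compare [mu] with the supremum, the set of eigenvalues must be bounded above; testing the form
   on an eigenvector shows that [mu] is a bound. *)
apply: le_trans (hmu w) _; rewrite ler_pM2r //; apply: ub_le_sup => //.
exists mu => a /eigenvalueP[v hv v0].
have Lv : L *m v^T = a *: v^T by rewrite -{1}Lsym -trmx_mul hv linearZ.
have vp : 0 < sqnorm v^T.
  rewrite lt_def sqnorm_ge0 andbT; apply: contraNneq v0 => /sqnorm_eq0 h.
  by rewrite -[v]trmxK h trmx0.
by rewrite -(ler_pM2r vp); apply: le_trans (hmu v^T); rewrite /wsqnorm Lv innerZr.
Qed.

(** A matrix and its transpose have the same operator norm: Young's inequality with weight [c]
    applied to [z] and [B *m (B^T *m z)]. *)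
Lemma sqnorm_trmx_mul_le (a b : nat) (B : 'M[R]_(a, b)) (c : R) : 0 < c ->
  (forall u, sqnorm (B *m u) <= c * sqnorm u) ->
  forall z, sqnorm (B^T *m z) <= c * sqnorm z.
Proof.
move=> c0 hB z; have := inner_Young z (B *m (B^T *m z)) c0.
rewrite inner_mulmx -/(sqnorm _).
have h : c^-1 * sqnorm (B *m (B^T *m z)) <= sqnorm (B^T *m z) by rewrite ler_pdivrMl.
lra.
Qed.

End Rayleigh.

(** * Kronecker products and block-diagonal matrices *)

Section BlockMatrices.
Context {R : realType}.

Lemma mulmx_cV_ext (a b : nat) (B C : 'M[R]_(a, b)) :
  (forall u : 'cV_b, B *m u = C *m u) -> B = C.
Proof.
move=> h; apply/matrixP => i j.
by have /matrixP/(_ i 0) := h (delta_mx j 0); rewrite -!colE !mxE.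
Qed.

Lemma kronI_mxcol (s a b : nat) (P : 'M[R]_(a, b)) (y : 'I_b -> 'cV[R]_s) :
  kronI s P *m \mxcol_j y j = \mxcol_i \sum_j P i j *: y j.
Proof.
rewrite /kronI mxblockEv mxcol_mul; apply: eq_mxcol => i.
by rewrite mul_mxrow_mxcol; apply: eq_bigr => j _; rewrite mul_scalar_mx.
Qed.

Lemma tr_kronI (s a b : nat) (P : 'M[R]_(a, b)) : (kronI s P)^T = kronI s P^T.
Proof.
by rewrite /kronI tr_mxblock; apply: eq_mxblock => i j; rewrite tr_scalar_mx mxE.
Qed.

Lemma kronI_mul (s a b c : nat) (P : 'M[R]_(a, b)) (P' : 'M[R]_(b, c)) :
  kronI s P *m kronI s P' = kronI s (P *m P').
Proof.
rewrite /kronI mul_mxblock; apply: eq_mxblock => i j.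
rewrite mxE rmorph_sum /=; apply: eq_bigr => k _.
by rewrite -scalar_mxM.
Qed.

Lemma kronI1 (s a : nat) : kronI s (1%:M : 'M[R]_a) = 1%:M.
Proof.
apply: mulmx_cV_ext => u; rewrite mul1mx -[u]submxcolK kronI_mxcol.
apply: eq_mxcol => i; rewrite (bigD1 i) //= big1 => [|j ji].
  by rewrite mxE eqxx scale1r addr0.
by rewrite mxE eq_sym (negbTE ji) scale0r.
Qed.

(** Regrouped by the coordinate [c] inside the blocks, the Kronecker product acts as [U] on each
    slice, where the Rayleigh bound applies. *)
Lemma kronI_sqnorm_le (s r m : nat) (U : 'M[R]_(r, m)) :
  forall Y, sqnorm (kronI s U *m Y) <= lambda_max (U^T *m U) * sqnorm Y.
Proof.
move=> Y; rewrite -[Y]submxcolK kronI_mxcol.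
move: (submxcol Y) => y; rewrite /sqnorm !inner_mxcol.
have -> : \sum_i inner (y i) (y i) = \sum_(c < s) sqnorm (\col_i y i c 0).
  rewrite /sqnorm; under eq_bigr do rewrite innerE; under [RHS]eq_bigr do rewrite innerE.
  by rewrite exchange_big; do 2!apply: eq_bigr => ? _; rewrite !mxE.
have -> : \sum_(i < r) inner (\sum_j U i j *: y j) (\sum_j U i j *: y j) =
    \sum_(c < s) sqnorm (U *m \col_i y i c 0).
  rewrite /sqnorm; under eq_bigr do rewrite innerE; under [RHS]eq_bigr do rewrite innerE.
  rewrite exchange_big; apply: eq_bigr => c _; apply: eq_bigr => i _.
  rewrite (_ : (\sum_j U i j *: y j) c 0 = (U *m \col_i y i c 0) i 0) //.
  by rewrite summxE mxE; apply: eq_bigr => j _; rewrite !mxE.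
rewrite mulr_sumr; apply: ler_sum => c _.
have := @rayleigh_le_lambda_max _ _ (U^T *m U) _ (\col_i y i c 0).
by rewrite trmx_mul trmxK /wsqnorm -mulmxA (inner_mulmx U^T) trmxK; apply.
Qed.

Lemma bdiag_mxcol (m : nat) (s : 'I_m -> nat) (c : 'I_m -> R) (u : forall i, 'cV[R]_(s i)) :
  bdiag s c *m \mxcol_i u i = \mxcol_i (c i *: u i).
Proof. by rewrite /bdiag mul_mxdiag_mxcol; apply: eq_mxcol => i; rewrite mul_scalar_mx. Qed.

Lemma tr_bdiag (m : nat) (s : 'I_m -> nat) (c : 'I_m -> R) : (bdiag s c)^T = bdiag s c.
Proof. by rewrite /bdiag tr_mxdiag; apply: eq_mxdiag => i; rewrite tr_scalar_mx. Qed.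

Lemma bdiagM (m : nat) (s : 'I_m -> nat) (c c' : 'I_m -> R) :
  bdiag s c *m bdiag s c' = bdiag s (fun i => c i * c' i).
Proof.
apply: mulmx_cV_ext => u; rewrite -mulmxA -[u]submxcolK !bdiag_mxcol.
by apply: eq_mxcol => i; rewrite scalerA.
Qed.

Lemma eq_bdiag (m : nat) (s : 'I_m -> nat) (c c' : 'I_m -> R) :
  (forall i, c i = c' i) -> bdiag s c = bdiag s c'.
Proof. by move=> h; apply: eq_mxdiag => i; rewrite h. Qed.

Lemma bdiag1 (m : nat) (s : 'I_m -> nat) : bdiag s (fun=> 1 : R) = 1%:M.
Proof. exact: mxdiagZ. Qed.

Lemma invmx_bdiag (m : nat) (s : 'I_m -> nat) (c : 'I_m -> R) : (forall i, 0 < c i) ->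
  invmx (bdiag s c) = bdiag s (fun i => (c i)^-1).
Proof.
move=> c0; have h : bdiag s c *m bdiag s (fun i => (c i)^-1) = 1%:M.
  by rewrite bdiagM -(bdiag1 s); apply: eq_bdiag => i; rewrite mulfV // gt_eqF.
have [cu _] := mulmx1_unit h.
by rewrite -[LHS]mulmx1 -h mulKmx.
Qed.

Lemma wsqnorm_bdiag (m : nat) (s : 'I_m -> nat) (c : 'I_m -> R) u :
  wsqnorm (bdiag s c) u = \sum_i c i * sqnorm (submxcol u i).
Proof.
rewrite -{1}[u]submxcolK /wsqnorm bdiag_mxcol inner_mxcol.
by apply: eq_bigr => i _; rewrite innerZr.
Qed.

Lemma bdiag_coercive (m : nat) (s : 'I_m -> nat) (c : 'I_m -> R) : (forall i, 0 < c i) ->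
  exists C, 0 <= C /\ forall u, sqnorm u <= C * wsqnorm (bdiag s c) u.
Proof.
move=> c0; exists (\sum_i (c i)^-1); split; first by apply: sumr_ge0 => i _; rewrite invr_ge0 ltW.
move=> u; have -> : sqnorm u = \sum_i sqnorm (submxcol u i).
  by rewrite -{1}[u]submxcolK /sqnorm inner_mxcol.
rewrite wsqnorm_bdiag mulr_suml; apply: ler_sum => i _.
rewrite (bigD1 i) //= mulrDr mulKf ?gt_eqF // lerDl mulr_ge0 ?invr_ge0 ?(ltW (c0 i)) //.
by apply: sumr_ge0 => j _; rewrite mulr_ge0 ?sqnorm_ge0 // ltW.
Qed.

Lemma wsqnorm_bdiag_le (m : nat) (s : 'I_m -> nat) (c : 'I_m -> R) (a : R) :
  (forall i, c i <= a) -> forall u, wsqnorm (bdiag s c) u <= a * sqnorm u.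
Proof.
move=> ca u; have -> : sqnorm u = \sum_i sqnorm (submxcol u i).
  by rewrite -{1}[u]submxcolK /sqnorm inner_mxcol.
rewrite wsqnorm_bdiag mulr_sumr; apply: ler_sum => i _.
by rewrite ler_wpM2r // sqnorm_ge0.
Qed.

End BlockMatrices.

(** * The matrices of the method: closed form and coercivity *)

Section AlgorithmMatrices.
Context {R : realType} (m r s : nat) (n : 'I_m -> nat).
Variables (theta alpha gamma : 'I_m -> R) (beta : R) (U : 'M[R]_(r, m)).
Hypothesis theta02 : forall i, 0 < theta i < 2.
Hypothesis alpha0 : forall i, 0 < alpha i.
Hypothesis gamma0 : forall i, 0 < gamma i.
Hypothesis beta0 : 0 < beta.

Let theta0 i : 0 < theta i. Proof. by have /andP[] := theta02 i. Qed.

Local Notation Q := (Qmat n s alpha gamma beta U).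
Local Notation M := (Mmat n s theta gamma U).
Local Notation H := (Hmat n s theta alpha gamma beta U).
Local Notation D := (Dmat n s theta alpha gamma beta U).
Local Notation UU := (kronI s U).

(** Closed form of [H]: the off-diagonal blocks of [Q] and [M] cancel, so symmetry and coercivity
    can be read off a block-diagonal matrix. *)
Let H' : 'M[R]_((\sum_(i < m) n i + \sum_(i < m) s) + \sum_(j < r) s) :=
  block_mx (block_mx (bdiag n (fun i => (alpha i * theta i)^-1)) 0
                             0 (bdiag (fun=> s) (fun i => (gamma i)^-1)))
                   0 0 (beta^-1)%:M.

Lemma Qmat_col (a : 'cV[R]_(\sum_(i < m) n i)) (b : 'cV[R]_(\sum_(i < m) s))
    (c : 'cV[R]_(\sum_(j < r) s)) : Q *m col_mx (col_mx a b) c =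
  col_mx (col_mx (bdiag n (fun i => (alpha i)^-1) *m a)
    (bdiag (fun=> s) (fun i => (gamma i)^-1) *m b - UU^T *m c)) (beta^-1 *: c).
Proof.
rewrite /Qmat !invmx_bdiag // !mul_block_col mul_col_mx !mul0mx mulNmx add0r.
by rewrite mul_scalar_mx addr0 add_col_mx addr0 add0r.
Qed.

Lemma Mmat_col (a : 'cV[R]_(\sum_(i < m) n i)) (b : 'cV[R]_(\sum_(i < m) s))
    (c : 'cV[R]_(\sum_(j < r) s)) : M *m col_mx (col_mx a b) c =
  col_mx (col_mx (bdiag n theta *m a) (b - bdiag (fun=> s) gamma *m (UU^T *m c))) c.
Proof.
rewrite /Mmat !mul_block_col mul_col_mx !mul0mx mulNmx add0r !mul1mx addr0.
by rewrite add_col_mx addr0 add0r mulmxA.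
Qed.

Let H'_col (a : 'cV[R]_(\sum_(i < m) n i)) (b : 'cV[R]_(\sum_(i < m) s))
    (c : 'cV[R]_(\sum_(j < r) s)) : H' *m col_mx (col_mx a b) c =
  col_mx (col_mx (bdiag n (fun i => (alpha i * theta i)^-1) *m a)
                 (bdiag (fun=> s) (fun i => (gamma i)^-1) *m b)) (beta^-1 *: c).
Proof. by rewrite /H' !mul_block_col !mul0mx mul_scalar_mx ?(addr0, add0r). Qed.

Let H'M : H' *m M = Q.
Proof.
apply: mulmx_cV_ext => u; rewrite -mulmxA -[u]vsubmxK -[usubmx u]vsubmxK.
rewrite Mmat_col Qmat_col H'_col; congr (col_mx (col_mx _ _) _).
  rewrite mulmxA bdiagM; congr (_ *m _); apply: eq_bdiag => i.
  by field; rewrite !gt_eqF.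
rewrite mulmxBr (mulmxA _ _ (UU^T *m _)) bdiagM; congr (_ - _).
rewrite -[RHS]mul1mx; congr (_ *m _).
by rewrite -[RHS](bdiag1 (fun=> s)); apply: eq_bdiag => i; rewrite mulVf // gt_eqF.
Qed.

Let Munit : M \in unitmx.
Proof.
pose M' : 'M[R]_((\sum_(i < m) n i + \sum_(i < m) s) + \sum_(j < r) s) :=
  block_mx (block_mx (bdiag n (fun i => (theta i)^-1)) 0 0 1%:M)
           (col_mx 0 (bdiag (fun=> s) gamma *m UU^T)) 0 1%:M.
have M'_col a b c : M' *m col_mx (col_mx a b) c =
    col_mx (col_mx (bdiag n (fun i => (theta i)^-1) *m a)
                   (b + bdiag (fun=> s) gamma *m (UU^T *m c))) c.
  rewrite /M' !mul_block_col mul_col_mx !mul0mx !mul1mx addr0 !add0r.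
  by rewrite add_col_mx addr0 mulmxA.
suff /mulmx1_unit[] : M *m M' = 1%:M by [].
apply: mulmx_cV_ext => u; rewrite -mulmxA -[u]vsubmxK -[usubmx u]vsubmxK.
rewrite M'_col Mmat_col mulmxA bdiagM addrK mul1mx; congr (col_mx (col_mx _ _) _).
rewrite -[RHS]mul1mx -(bdiag1 n); congr (_ *m _); apply: eq_bdiag => i.
by rewrite mulfV // gt_eqF.
Qed.

Lemma Hmat_mul_Mmat : H *m M = Q.
Proof. by rewrite /Hmat mulmxKV. Qed.

Let HE : H = H'.
Proof. by rewrite /Hmat -H'M mulmxK. Qed.

Lemma tr_Hmat : H^T = H.
Proof. by rewrite HE /H' !tr_block_mx !tr_bdiag tr_scalar_mx !trmx0. Qed.

Lemma Hmat_coercive : exists C, 0 < C /\ forall u, sqnorm u <= C * wsqnorm H u.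
Proof.
have [i|C1 [C10 hC1]] := @bdiag_coercive R m n (fun i => (alpha i * theta i)^-1).
  by rewrite invr_gt0 mulr_gt0.
have [i|C2 [C20 hC2]] := @bdiag_coercive R m (fun=> s) (fun i => (gamma i)^-1).
  by rewrite invr_gt0.
exists (C1 + C2 + beta); split; first by rewrite ltr_wpDl // addr_ge0.
move=> u; rewrite HE /wsqnorm -[u]vsubmxK -[usubmx u]vsubmxK H'_col /sqnorm !inner_col_mx.
move: (usubmx (usubmx u)) (dsubmx (usubmx u)) (dsubmx u) => a b c.
have h1 := hC1 a; have h2 := hC2 b.
rewrite innerZr -!/(wsqnorm _ _) -!/(sqnorm _).
set x1 := wsqnorm _ _ in h1 *; set x2 := wsqnorm _ _ in h2 *.
have x10 : 0 <= x1.
  rewrite /x1 wsqnorm_bdiag sumr_ge0 // => i _.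
  by rewrite mulr_ge0 ?sqnorm_ge0 // invr_ge0 mulr_ge0 // ltW.
have x20 : 0 <= x2.
  rewrite /x2 wsqnorm_bdiag sumr_ge0 // => i _.
  by rewrite mulr_ge0 ?sqnorm_ge0 // invr_ge0 // ltW.
have h3 : sqnorm c = beta * (beta^-1 * sqnorm c) by rewrite mulVKf // gt_eqF.
have x30 : 0 <= beta^-1 * sqnorm c by rewrite mulr_ge0 ?sqnorm_ge0 // invr_ge0 ltW.
set x3 := beta^-1 * sqnorm c in h3 x30 *; rewrite h3.
have := ltW beta0; nra.
Qed.

(** The inverse hidden in [H] disappears since [M^T H M = M^T Q]; later arguments use [D] only in
    this form. *)
Lemma wsqnorm_Dmat u : wsqnorm D u = 2 * inner u (Q *m u) - inner (M *m u) (Q *m u).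
Proof.
rewrite /Dmat /wsqnorm -mulmxA Hmat_mul_Mmat mulmxBl mulmxDl !inner_lin.
rewrite (inner_mulmx Q^T) trmxK (innerC (Q *m u)) -mulmxA (inner_mulmx M^T) trmxK; lra.
Qed.

Hypothesis step : forall i, 0 < gamma i * beta < (lambda_max (U^T *m U))^-1.
Hypothesis m0 : (0 < m)%N.

(** The cross terms between the second and third blocks cancel, leaving [(2 - theta i) / alpha i],
    [(gamma i)^-1], and the identity over [beta] minus [U Gamma U^T]. The step-size condition makes
    this last block positive definite. *)
Lemma Dmat_coercive : exists C, 0 < C /\ forall u, sqnorm u <= C * wsqnorm D u.
Proof.
pose lam := lambda_max (U^T *m U).
have [i0 hi0] : exists i0, forall i, gamma i <= gamma i0.
  pose i1 := Ordinal m0; case: (@arg_maxP _ _ _ i1 predT gamma) => // i0 _ h.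
  by exists i0 => i; exact: h.
have /andP[gb gbl] := step i0.
have lam0 : 0 < lam by rewrite -invr_gt0; exact: lt_trans gbl.
(* With the largest [gamma], [rho] is the fraction of the third block that the coupling consumes;
   the remaining [1 - rho] yields [C3]. *)
pose rho := gamma i0 * beta * lam.
have rho1 : rho < 1 by rewrite -ltr_pdivlMr // mul1r.
have hU (c : 'cV[R]_(\sum_(j < r) s)) :
    wsqnorm (bdiag (fun=> s) gamma) (UU^T *m c) <= rho * (beta^-1 * sqnorm c).
  apply: le_trans (wsqnorm_bdiag_le hi0 _) _.
  have := sqnorm_trmx_mul_le lam0 (@kronI_sqnorm_le R s r m U) c => h.
  have -> : rho * (beta^-1 * sqnorm c) = gamma i0 * (lam * sqnorm c).
    by rewrite /rho; field; rewrite gt_eqF.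
  by rewrite ler_pM2l.
have [i|C1 [C10 hC1]] := @bdiag_coercive R m n (fun i => (2 - theta i) / alpha i).
  by rewrite divr_gt0 // subr_gt0; have /andP[] := theta02 i.
have [i|C2 [C20 hC2]] := @bdiag_coercive R m (fun=> s) (fun i => (gamma i)^-1).
  by rewrite invr_gt0.
have r0 : 0 < 1 - rho by lra.
pose C3 := beta / (1 - rho).
have C30 : 0 < C3 by rewrite divr_gt0.
exists (C1 + C2 + C3); split; first by rewrite ltr_wpDl // addr_ge0.
move=> u; rewrite wsqnorm_Dmat -[u]vsubmxK -[usubmx u]vsubmxK Qmat_col Mmat_col.
move: (usubmx (usubmx u)) (dsubmx (usubmx u)) (dsubmx u) => a b c.
rewrite /sqnorm !inner_col_mx !inner_lin -!/(sqnorm _).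
have h1 := hC1 a; have h2 := hC2 b; have h3 := hU c.
set x2 := inner b (_ *m b).
have -> : inner (bdiag (fun=> s) gamma *m (UU^T *m c))
    (bdiag (fun=> s) (fun i => (gamma i)^-1) *m b) = inner b (UU^T *m c).
  rewrite -{1}[bdiag _ gamma]tr_bdiag -inner_mulmx mulmxA bdiagM.
  rewrite [X in X *m b](_ : _ = 1%:M) ?mul1mx 1?innerC //.
  by rewrite -(bdiag1 (fun=> s)); apply: eq_bdiag => i; rewrite mulfV // gt_eqF.
rewrite (innerC (bdiag _ gamma *m _)) -/(wsqnorm _ (UU^T *m c)).
set y := inner b (UU^T *m c); set z := wsqnorm _ (UU^T *m c) in h3 *.
have -> : inner (bdiag n theta *m a) (bdiag n (fun i => (alpha i)^-1) *m a) =
   2 * inner a (bdiag n (fun i => (alpha i)^-1) *m a)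
   - wsqnorm (bdiag n (fun i => (2 - theta i) / alpha i)) a.
  rewrite -{1}[bdiag n theta]tr_bdiag -inner_mulmx mulmxA bdiagM -!/(wsqnorm _ _).
  rewrite !wsqnorm_bdiag mulr_sumr -sumrB; apply: eq_bigr => i _.
  by field; rewrite gt_eqF.
set w := inner a _; set x1 := wsqnorm _ a in h1 *.
have x10 : 0 <= x1.
  rewrite /x1 wsqnorm_bdiag sumr_ge0 // => i _.
  rewrite mulr_ge0 ?sqnorm_ge0 // divr_ge0 ?(ltW (alpha0 i)) // subr_ge0 ltW //.
  by have /andP[] := theta02 i.
have x20 : 0 <= x2.
  rewrite /x2 -/(wsqnorm _ _) wsqnorm_bdiag sumr_ge0 // => i _.
  by rewrite mulr_ge0 ?sqnorm_ge0 // invr_ge0 // ltW.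
have x30 : 0 <= beta^-1 * sqnorm c by rewrite mulr_ge0 ?sqnorm_ge0 // invr_ge0 ltW.
set x3 := beta^-1 * sqnorm c in h3 x30 *.
have hc : sqnorm c = C3 * ((1 - rho) * x3).
  by rewrite /C3 /x3; field; rewrite !gt_eqF.
set x4 := (1 - rho) * x3 in hc *.
have x40 : 0 <= x4 by rewrite mulr_ge0 // ltW.
have x4z : x4 <= x3 - z by rewrite /x4; lra.
rewrite hc; apply: le_trans (_ : (C1 + C2 + C3) * (x1 + x2 + x4) <= _).
  move: h1 h2; rewrite /wsqnorm -/x2 => h1 h2; have := ltW C30; nra.
by rewrite ler_wpM2l //; lra.
Qed.

End AlgorithmMatrices.

(** * Abstract prediction-correction scheme: energy inequalities and rate *)

Section PredictionCorrection.
Context {R : realType} (N : nat) (H Q M D : 'M[R]_N).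
Hypothesis HM : H *m M = Q.
Hypothesis Hsym : H^T = H.
Hypothesis wsqnormD : forall u, wsqnorm D u = 2 * inner u (Q *m u) - inner (M *m u) (Q *m u).

Lemma wsqnorm_correction (c d : 'cV[R]_N) : wsqnorm H (c - M *m d) =
  wsqnorm H c - 2 * inner c (Q *m d) + inner (M *m d) (Q *m d).
Proof.
rewrite /wsqnorm mulmxBr mulmxA HM !inner_lin (inner_mulmx H (M *m d) c) Hsym mulmxA HM.
by rewrite (innerC (Q *m d) c); lra.
Qed.

(** With [e = d - d'], the left side equals [wsqnorm H (M *m d) - 2 * inner w (Q *m e)], because the
    terms in [M *m e] cancel. Here [w] is the difference of two consecutive predictions. *)
Lemma prediction_monotone_step (d d' w V V' : 'cV[R]_N) : w = M *m d - (d - d') ->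
  0 <= inner w ((Q *m d + V) - (Q *m d' + V')) ->
  wsqnorm H (M *m d') + wsqnorm D (d - d') <= wsqnorm H (M *m d) + 2 * inner w (V - V').
Proof.
move=> hw; have -> : M *m d' = M *m d - M *m (d - d') by rewrite -mulmxBr subKr.
have -> : Q *m d + V - (Q *m d' + V') = Q *m (d - d') + (V - V').
  by rewrite mulmxBr opprD addrACA.
rewrite wsqnorm_correction wsqnormD (innerDr w (Q *m _)); set e := d - d' in hw *.
set y := inner w (V - V').
have -> : inner w (Q *m e) = inner (M *m d) (Q *m e) - inner e (Q *m e).
  by rewrite hw innerDl innerNl.
lra.
Qed.

(** The same expansion with the second prediction replaced by a zero [xs] of the operator. *)
Lemma fejer_step (xi xih xi' xs V : 'cV[R]_N) : xi' = xi - M *m (xi - xih) ->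
  0 <= inner (xih - xs) (Q *m (xi - xih) + V) ->
  wsqnorm H (xi' - xs) + wsqnorm D (xi - xih) <=
  wsqnorm H (xi - xs) + 2 * inner (xih - xs) V.
Proof.
move=> ->; rewrite addrAC wsqnorm_correction wsqnormD (innerDr _ (Q *m _)).
set d := xi - xih.
have -> : inner (xi - xs) (Q *m d) = inner d (Q *m d) + inner (xih - xs) (Q *m d).
  by rewrite -innerDl /d addrA subrK.
lra.
Qed.

Variables (xi xih V : nat -> 'cV[R]_N) (xs : 'cV[R]_N) (CH CD C t : R).
Let d k := xi k - xih k.
Hypothesis correction : forall k, xi k.+1 = xi k - M *m (xi k - xih k).
Hypothesis mono : forall k, 0 <= inner (xih k - xih k.+1)
  ((Q *m (xi k - xih k) + V k) - (Q *m (xi k.+1 - xih k.+1) + V k.+1)).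
Hypothesis mono_sol : forall k, 0 <= inner (xih k - xs) (Q *m (xi k - xih k) + V k).
Hypothesis CH0 : 0 < CH.
Hypothesis Hcoer : forall u, sqnorm u <= CH * wsqnorm H u.
Hypothesis CD0 : 0 < CD.
Hypothesis Dcoer : forall u, sqnorm u <= CD * wsqnorm D u.
Hypothesis C0 : 0 <= C.
Hypothesis t01 : 0 < t < 1.
Hypothesis Vle : forall k, sqnorm (V k) <= (C * t ^+ k) ^+ 2.

Lemma prediction_correction_step k :
  wsqnorm H (M *m (xi k.+1 - xih k.+1)) +
    wsqnorm D ((xi k - xih k) - (xi k.+1 - xih k.+1)) <=
  wsqnorm H (M *m (xi k - xih k)) + 2 * inner (xih k - xih k.+1) (V k - V k.+1).
Proof.
apply: prediction_monotone_step; last exact: mono.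
have -> : M *m (xi k - xih k) = xi k - xi k.+1 by rewrite correction subKr.
by apply/matrixP => i j; rewrite !mxE; ring.
Qed.

Let Hpsd u : 0 <= wsqnorm H u := coercive_psd CH0 Hcoer u.
Let Dpsd u : 0 <= wsqnorm D u := coercive_psd CD0 Dcoer u.

Let e k := C * t ^+ k.
Let e0 k : 0 <= e k. Proof. by rewrite mulr_ge0 // exprn_ge0 // ltW //; case/andP: t01. Qed.
Let eC k : e k <= C.
Proof.
have [t0 t1] := andP t01.
by rewrite ler_piMr // exprn_ile1 // ltW.
Qed.
Let eS k : e k.+1 <= e k.
Proof.
have [t0 t1] := andP t01; rewrite /e exprS mulrCA ler_piMl //; last exact: ltW.
exact: e0.
Qed.

(** The error term is split along [xih - xs = (xi - xs) - d]. The first piece grows the energy by a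
    factor [1 + K * e k]; Young's inequality charges the second to half of [wsqnorm D (d k)], and
    the other half is summed. The [+ 1] turns additive errors into multiplicative ones. *)
Let fejer_bounded : exists B, (forall k, wsqnorm H (xi k - xs) + 1 <= B) /\
  forall k, \sum_(0 <= j < k) (2^-1 * wsqnorm D (d j)) <= B.
Proof.
(* [CH + 1] pays for the piece along [xi - xs], and [2 * CD * C] for [sqnorm (V k)], through
   [e k ^+ 2 <= C * e k]. *)
pose K := CH + 1 + 2 * CD * C.
have K0 : 0 <= K by rewrite !addr_ge0 ?ler01 ?(ltW CH0) // !mulr_ge0 // ltW.
have [t0 t1] := andP t01; have CD0' := CD0; have CH0' := ltW CH0.
apply: (@quasi_fejer_bounded _ _ _ (fun k => K * e k) (K * (C / (1 - t)))).
- by move=> k; have := Hpsd (xi k - xs); lra.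
- by move=> k; have := Dpsd (d k); lra.
- by move=> k; rewrite mulr_ge0.
- move=> k; rewrite -!mulr_sumr ler_wpM2l // ler_wpM2l //.
  by apply: geom_sum_le; rewrite t1 ltW.
move=> k; have hf := fejer_step (correction k) (mono_sol k); rewrite -/(d k) in hf.
have hin : inner (xih k - xs) (V k) = inner (xi k - xs) (V k) + inner (- d k) (V k).
  by rewrite -innerDl; congr inner; apply/matrixP => i j; rewrite !mxE; ring.
have h1 := inner_le_small (xi k - xs) (e0 k) (Vle k).
have c0 : 0 < (2 * CD)^-1 by rewrite invr_gt0; lra.
have h2 := inner_Young (- d k) (V k) c0; rewrite invrK in h2.
have h3 : (2 * CD)^-1 * sqnorm (- d k) <= 2^-1 * wsqnorm D (d k).
  rewrite ler_pdivrMl; last lra.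
  have -> : sqnorm (- d k) = sqnorm (d k) by rewrite /sqnorm innerNl innerNr opprK.
  by have := Dcoer (d k); lra.
have h4 := Vle k; rewrite -/(e k) in h4 h1.
have h5 : e k ^+ 2 <= C * e k by rewrite expr2 ler_wpM2r.
have h6 := Hcoer (xi k - xs); have h7 := Hpsd (xi k - xs).
set a := wsqnorm H (xi k - xs) in h6 h7 hf *.
have h8 : e k * (sqnorm (xi k - xs) + 1) <= e k * ((CH + 1) * (a + 1)).
  by rewrite ler_wpM2l //; nra.
have h9 : 2 * CD * sqnorm (V k) <= 2 * CD * C * e k * (a + 1).
  apply: le_trans (_ : 2 * CD * (C * e k) <= _).
    by rewrite ler_wpM2l ?mulr_ge0 ?(ltW CD0) //; exact: le_trans h5.
  have h10 : 0 <= 2 * CD * C * e k by rewrite mulr_ge0 // mulr_ge0 // mulr_ge0 // ltW.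
  by rewrite mulrA; nra.
rewrite /K; nra.
Qed.

(** Bounded predictions make the inner-product error in [prediction_correction_step] at most a
    multiple of [t ^+ k], while summability of the [D]-norms passes to the residuals. *)
Lemma prediction_correction_rate :
  (fun k : nat => k%:R * wsqnorm H (M *m (xi k - xih k))) @ \oo --> (0 : R).
Proof.
have [B [hB hS]] := fejer_bounded.
have [t0 t1] := andP t01; have CD0' := CD0; have CH0' := ltW CH0.
have hd k : sqnorm (d k) <= 2 * CD * B.
  apply: le_trans (Dcoer _) _.
  have := hS k.+1; rewrite big_nat_recr //=.
  have : 0 <= \sum_(0 <= j < k) 2^-1 * wsqnorm D (d j).
    by apply: sumr_ge0 => j _; have := Dpsd (d j); lra.
  move=> h1 h2; have : wsqnorm D (d k) <= 2 * B by lra.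
  by move=> /(ler_wpM2l (ltW CD0)); lra.
pose B2 := 2 * (CH * B) + 2 * (2 * CD * B).
have hxh k : sqnorm (xih k - xs) <= B2.
  have -> : xih k - xs = (xi k - xs) - d k.
    by apply/matrixP => i j; rewrite !mxE; ring.
  apply: le_trans (sqnormB_le _ _) _; have := hd k; have := hB k.
  have := Hcoer (xi k - xs); rewrite /B2; nra.
have B20 : 0 <= B2 := le_trans (sqnorm_ge0 _) (hxh 0%N).
have [C3 [C30 hC3]] := wsqnorm_bounded (M^T *m H *m M).
have hs k : wsqnorm H (M *m d k) <= C3 * (2 * CD) * (2^-1 * wsqnorm D (d k)).
  have -> : wsqnorm H (M *m d k) = wsqnorm (M^T *m H *m M) (d k).
    by rewrite /wsqnorm -!mulmxA (inner_mulmx M^T) trmxK.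
  apply: le_trans (hC3 _) _; rewrite -mulrA ler_wpM2l //.
  by have := Dcoer (d k); lra.
apply: (@quasi_nonincreasing_little_o _ _ (C3 * (2 * CD) * B) (2 * C * (4 * B2 + 1)) t).
- by rewrite t1 ltW.
- by rewrite !mulr_ge0 // addr_ge0 // mulr_ge0.
- by move=> k; exact: Hpsd.
- move=> k; have := prediction_correction_step k.
  have := Dpsd ((xi k - xih k) - (xi k.+1 - xih k.+1)).
  have ek2 : 0 <= 2 * e k by rewrite mulr_ge0.
  have hV : sqnorm (V k - V k.+1) <= (2 * e k) ^+ 2.
    apply: le_trans (sqnormB_le _ _) _; have h1 := Vle k; have := Vle k.+1.
    rewrite -!/(e _) in h1 *; have := eS k; have := e0 k.+1; nra.
  have := inner_le_small (xih k - xih k.+1) ek2 hV.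
  have hx : sqnorm (xih k - xih k.+1) <= 4 * B2.
    have -> : xih k - xih k.+1 = (xih k - xs) - (xih k.+1 - xs).
      by apply/matrixP => i j; rewrite !mxE; ring.
    by apply: le_trans (sqnormB_le _ _) _; have := hxh k; have := hxh k.+1; lra.
  have : 2 * e k * (sqnorm (xih k - xih k.+1) + 1) <= 2 * C * (4 * B2 + 1) * t ^+ k.
    have -> : 2 * C * (4 * B2 + 1) * t ^+ k = 2 * e k * (4 * B2 + 1) by rewrite /e; ring.
    by rewrite ler_wpM2l //; lra.
  lra.
- move=> k; apply: le_trans (_ : \sum_(0 <= j < k) C3 * (2 * CD) * (2^-1 * wsqnorm D (d j)) <= _).
    by apply: ler_sum => j _; exact: hs.
  by rewrite -mulr_sumr ler_wpM2l // !mulr_ge0 // ltW.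
Qed.

End PredictionCorrection.

(** * The projection onto the polar cone *)

Section Projection.
Context {R : realType} (p q : nat).
Implicit Types u w : 'cV[R]_(p + q).

Lemma inKpol_projKpol u : inKpol (projKpol u).
Proof. by move=> j; rewrite /projKpol col_mxKd mxE le_max lexx orbT. Qed.

Lemma projKpol_variational u w : inKpol w -> inner (u - projKpol u) (w - projKpol u) <= 0.
Proof.
move=> hw; rewrite -{1}[u]vsubmxK -[w]vsubmxK /projKpol !opp_col_mx !add_col_mx inner_col_mx.
rewrite subrr inner0l add0r innerE; apply: sumr_le0 => j _.
have := hw j; move: (dsubmx u) (dsubmx w) => a b; rewrite !mxE.
by have [h|h] := leP (a j 0) 0; nra.
Qed.

(** The square of a positive part is nondecreasing; this lets the convexity inequality of [g] pass
    through the squared projection. *)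
Lemma sqnorm_projKpol_le u w : usubmx u = usubmx w ->
  (forall j, dsubmx u j 0 <= dsubmx w j 0) -> sqnorm (projKpol u) <= sqnorm (projKpol w).
Proof.
move=> huw h; rewrite /projKpol /sqnorm !inner_col_mx huw lerD2l !innerE.
apply: ler_sum => j _; have := h j; move: (dsubmx u) (dsubmx w) => a b; rewrite !mxE => hj.
by have [h1|h1] := leP (a j 0) 0; have [h2|h2] := leP (b j 0) 0; nra.
Qed.

(** Descent inequality for half the squared norm of the projection, a function whose gradient is the
    1-Lipschitz map [projKpol]. *)
Lemma sqnorm_projKpol_descent u w : sqnorm (projKpol (u + w)) <=
  sqnorm (projKpol u) + 2 * inner (projKpol u) w + sqnorm w.
Proof.
rewrite -{2 3}[w]vsubmxK /projKpol /sqnorm !inner_col_mx.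
have -> : usubmx (u + w) = usubmx u + usubmx w by apply/matrixP => i j; rewrite !mxE.
have -> : dsubmx (u + w) = dsubmx u + dsubmx w by apply/matrixP => i j; rewrite !mxE.
move: (usubmx u) (usubmx w) (dsubmx u) (dsubmx w) => a a' b b'.
have h1 : inner (a + a') (a + a') = inner a a + 2 * inner a a' + inner a' a'.
  by rewrite !inner_lin (innerC a' a); lra.
set P := map_mx _ b; set P' := map_mx _ (b + b').
have h2 : inner P' P' <= inner P P + 2 * inner P b' + inner b' b'.
  rewrite !innerE mulr_sumr -!big_split /=; apply: ler_sum => j _; rewrite !mxE.
  by have [h1'|h1'] := leP (b j 0) 0; have [h2|h2] := leP (b j 0 + b' j 0) 0; nra.
lra.
Qed.

Lemma inK_inner u w : inK u -> inKpol w -> inner u w <= 0.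
Proof.
move=> [hu1 hu2] hw; rewrite -[u]vsubmxK -[w]vsubmxK inner_col_mx hu1 inner0l add0r innerE.
by apply: sumr_le0 => j _; apply: mulr_le0_ge0.
Qed.

End Projection.

(** * From the augmented subproblem to a subgradient of the Lagrangian *)

Section ProximalStep.
Context {R : realType}.

Lemma le0_of_quadratic_bound (a b : R) : (forall t, 0 < t <= 1 -> t * a <= t ^+ 2 * b) -> a <= 0.
Proof.
move=> h; rewrite leNgt; apply/negP => a0.
have := h 1; rewrite ltr01 lexx expr1n !mul1r => /(_ isT) ab.
have b0 : 0 < b by exact: lt_le_trans ab.
have t0 : 0 < a / (2 * b) by rewrite divr_gt0 // mulr_gt0.
have t1 : a / (2 * b) <= 1 by rewrite ler_pdivrMr ?mulr_gt0 //; lra.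
have := h (a / (2 * b)); rewrite t0 t1 => /(_ isT); rewrite expr2 -mulrA ler_pM2l //.
have -> : a / (2 * b) * b = a / 2 by field; rewrite gt_eqF.
lra.
Qed.

                                                                                       
                                                                                          
(** The subgradient inequality is tested along the segment from [xh] to [w]. The penalty and
    proximal terms contribute their linear parts, with multiplier [yh], plus terms of order
    [t ^+ 2], which disappear as [t] tends to 0. *)
Lemma subgrad_phik (p q ni : nat) (fi : 'cV[R]_ni -> R) (Ai : 'M[R]_(p, ni)) (bi : 'cV[R]_p)
    (gi : 'cV[R]_ni -> 'cV[R]_q) (Om : set 'cV[R]_ni) (alphai gammai : R)
    (xk xh v : 'cV[R]_ni) (y : 'cV[R]_(p + q)) :
  0 < alphai -> 0 < gammai -> cvx_fun fi -> (forall j, cvx_fun (fun u => gi u j 0)) ->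
  cvx_set Om ->
  subgrad (phik fi Ai bi gi alphai gammai xk y) Om xh v ->
  subgrad (fun u => fi u + inner (projKpol (y + gammai *: Gfun Ai bi gi xh)) (Gfun Ai bi gi u))
    Om xh (alphai^-1 *: (xk - xh) + v).
Proof.
move=> a0 g0 fc gc Oc [Oxh hsub]; split=> // w Ow.
set G := Gfun Ai bi gi; set yh := projKpol _; pose dG := G w - G xh.
have key (t : R) : 0 < t <= 1 ->
   t * (inner v (w - xh) - (fi w - fi xh) - inner yh dG
        - alphai^-1 * inner (xh - xk) (w - xh))
   <= t ^+ 2 * (2^-1 * gammai * sqnorm dG + 2^-1 * alphai^-1 * sqnorm (w - xh)).
  move=> /andP[t0 t1]; have t01 : 0 <= t <= 1 by rewrite t1 ltW.
  have := hsub _ (Oc _ _ _ Ow Oxh t01).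
  set xt := t *: w + (1 - t) *: xh.
  have -> : xt - xh = t *: (w - xh) by apply/matrixP => i j; rewrite !mxE; ring.
  rewrite /phik innerZr -/G.
  have hf := fc w xh t t01; rewrite -/xt in hf.
  have hx : sqnorm (xt - xk) = sqnorm (xh - xk) + 2 * t * inner (xh - xk) (w - xh)
      + t ^+ 2 * sqnorm (w - xh).
    have -> : xt - xk = (xh - xk) + t *: (w - xh) by apply/matrixP => i j; rewrite !mxE; ring.
    move: (xh - xk) (w - xh) => c e; rewrite /sqnorm !inner_lin (innerC e c); ring.
  have hP : sqnorm (projKpol (y + gammai *: G xt)) <=
      sqnorm yh + 2 * t * gammai * inner yh dG + t ^+ 2 * gammai ^+ 2 * sqnorm dG.
    (* [G xt] is compared with the linear interpolation of [G]: the equality block is affine, and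
       the convex block lies below it. *)
    apply: le_trans (_ : sqnorm (projKpol ((y + gammai *: G xh) + (t * gammai) *: dG)) <= _).
      apply: sqnorm_projKpol_le.
        have hG u : usubmx (G u) = Ai *m u - bi by rewrite col_mxKu.
        have -> : usubmx (y + gammai *: G xt) = usubmx y + gammai *: usubmx (G xt).
          by apply/matrixP => i j; rewrite !mxE.
        have -> : usubmx (y + gammai *: G xh + (t * gammai) *: dG) =
           usubmx y + gammai *: usubmx (G xh) + (t * gammai) *: (usubmx (G w) - usubmx (G xh)).
          by apply/matrixP => i j; rewrite !mxE.
        rewrite !hG /xt mulmxDr -!scalemxAr; move: (Ai *m w) (Ai *m xh) => c e.
        by apply/matrixP => i j; rewrite !mxE; ring.
      move=> j; have hG u : dsubmx (G u) = gi u by rewrite col_mxKd.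
      have -> : dsubmx (y + gammai *: G xt) j 0 = dsubmx y j 0 + gammai * dsubmx (G xt) j 0.
        by rewrite !mxE.
      have -> : dsubmx (y + gammai *: G xh + (t * gammai) *: dG) j 0 =
         dsubmx y j 0 + gammai * dsubmx (G xh) j 0
         + t * gammai * (dsubmx (G w) j 0 - dsubmx (G xh) j 0).
        by rewrite !mxE.
      rewrite !hG; have := ler_wpM2l (ltW g0) (gc j w xh t t01); rewrite -/xt; lra.
    apply: le_trans (sqnorm_projKpol_descent _ _) _; rewrite -/yh /sqnorm !inner_lin.
    by rewrite le_eqVlt; apply/predU1P; left; ring.
  have hP' := ler_wpM2l (_ : 0 <= (2 * gammai)^-1) hP.
  rewrite invr_ge0 mulr_ge0 ?(ltW g0) // in hP'; move/(_ isT) in hP'.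
  rewrite -/yh hx => hh.
  have e1 : (2 * gammai)^-1 *
      (sqnorm yh + 2 * t * gammai * inner yh dG + t ^+ 2 * gammai ^+ 2 * sqnorm dG)
     = (2 * gammai)^-1 * sqnorm yh + t * inner yh dG + t ^+ 2 * (2^-1 * gammai * sqnorm dG).
    by field; rewrite gt_eqF.
  rewrite e1 in hP'.
  have e2 : (2 * alphai)^-1 *
      (sqnorm (xh - xk) + 2 * t * inner (xh - xk) (w - xh) + t ^+ 2 * sqnorm (w - xh))
    = (2 * alphai)^-1 * sqnorm (xh - xk) + t * (alphai^-1 * inner (xh - xk) (w - xh))
      + t ^+ 2 * (2^-1 * alphai^-1 * sqnorm (w - xh)).
    by field; rewrite gt_eqF.
  rewrite e2 in hh; lra.
have := le0_of_quadratic_bound key.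
rewrite (innerDl _ (alphai^-1 *: _)) innerZl -(opprB xh xk) innerNl /dG (innerDr yh) innerNr.
lra.
Qed.

End ProximalStep.

(** * The saddle operator and its monotonicity *)

Section SaddleOperator.
Context {R : realType} (m r p q : nat) (n : 'I_m -> nat).
Variables (f : forall i, 'cV[R]_(n i) -> R) (A : forall i, 'M[R]_(p, n i)).
Variables (b : 'I_m -> 'cV[R]_p) (g : forall i, 'cV[R]_(n i) -> 'cV[R]_q).
Variables (Om : forall i, set 'cV[R]_(n i)) (U : 'M[R]_(r, m)).

Local Notation G i := (Gfun (A i) (b i) (@g i)).
Local Notation UU := (kronI (p + q) U).
Local Notation Phi := (PhiSet f A b g Om U).

(** Four subgradient inequalities are added, in [x] and in [Y], each tested at the other point. All
    values of [f] and of the coupling with [G] cancel, and the [U] terms cancel by skew symmetry. *)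
Lemma PhiSet_monotone x Y Z s x' Y' Z' s' : Phi x Y Z s -> Phi x' Y' Z' s' ->
  0 <= inner (xi_of x Y Z - xi_of x' Y' Z') (s - s').
Proof.
move=> [w1 [_ [[KY [Ox hx]] [[u [_ [_ hY]] <-] ->]]]].
move=> [w1' [_ [[KY' [Ox' hx']] [[u' [_ [_ hY']] <-] ->]]]].
have {hx} := hx _ Ox'; have {hx'} := hx' _ Ox.
have KYs (W : 'I_m -> 'cV[R]_(p + q)) : (forall i, inKpol (W i)) ->
    forall i, inKpol (submxcol (stack W) i) by move=> h i; rewrite mxcolK.
have {hY} := hY _ (KYs _ KY'); have {hY'} := hY' _ (KYs _ KY).
have subK (W : forall i, 'cV[R]_(n i)) i : submxcol (stack W) i = W i by exact: mxcolK.
have subK' (W : 'I_m -> 'cV[R]_(p + q)) i : submxcol (stack W) i = W i by exact: mxcolK.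
under eq_bigr do rewrite subK'; under [X in _ <= X -> _]eq_bigr do rewrite subK'.
under [X in _ -> X + _ <= _ -> _]eq_bigr do rewrite subK'.
under [X in _ -> _ <= X -> _]eq_bigr do rewrite subK'.
under [X in _ -> _ -> X + _ <= _ -> _]eq_bigr do rewrite subK.
under [X in _ -> _ -> _ <= X -> _]eq_bigr do rewrite subK.
under [X in _ -> _ -> _ -> X + _ <= _ -> _]eq_bigr do rewrite subK.
under [X in _ -> _ -> _ -> _ <= X -> _]eq_bigr do rewrite subK.
have sumS (a : forall i, 'cV[R]_(n i)) (c : 'I_m -> 'cV[R]_(p + q)) :
    \sum_i (f (a i) + inner (c i) (G i (a i))) =
    \sum_i f (a i) + \sum_i inner (c i) (G i (a i)) by rewrite big_split.
rewrite !sumrB !sumS.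
rewrite /xi_of !opp_col_mx !add_col_mx !inner_col_mx.
set X := stack x; set X' := stack x'; set V := stack Y; set V' := stack Y'.
have skew (a : 'cV[R]_(\sum_(i < m) (p + q))) (c : 'cV[R]_(\sum_(j < r) (p + q))) :
  inner a (UU^T *m c) = inner c (UU *m a) by rewrite inner_mulmx trmxK innerC.
rewrite !opprK !inner_lin !skew.
rewrite !(innerC w1) !(innerC w1') !(innerC u) !(innerC u').
move: (UU *m V) (UU *m V') => a a'; lra.
Qed.

(** * Existence of a zero of the saddle operator *)

Section KKT.
Hypothesis m0 : (0 < m)%N.
Hypothesis nullU : forall w : 'cV[R]_m, U *m w = 0 -> exists c : R, w = c *: const_mx 1.
Hypothesis U1 : U *m (const_mx 1 : 'cV[R]_m) = 0.
Hypothesis fc : forall i, cvx_fun (f (i := i)).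
Hypothesis gc : forall i (j : 'I_q), cvx_fun (fun u => g (i := i) u j 0).
Hypothesis Oc : forall i, cvx_set (Om (i := i)).

Lemma kronI_consensus (y : 'cV[R]_(p + q)) : UU *m stack (fun=> y) = 0.
Proof.
rewrite /stack kronI_mxcol -[RHS]submxcolK; apply: eq_mxcol => j.
rewrite submxcol0 -scaler_suml.
have /matrixP/(_ j 0) := U1; rewrite !mxE.
by under eq_bigr do rewrite mxE mulr1; move=> ->; rewrite scale0r.
Qed.

(** The kernel of [UU] consists of vectors with equal blocks, and a stack with zero block sum is
    orthogonal to all of them. *)
Lemma sum0_in_range (u : 'I_m -> 'cV[R]_(p + q)) : \sum_i u i = 0 ->
  exists Z, stack u = UU^T *m Z.
Proof.
move=> u0; apply: orthogonal_ker_range => h hU.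
pose i0 := Ordinal m0.
have hc i : submxcol h i = submxcol h i0.
  apply/colP => c; move: hU; rewrite -[h]submxcolK kronI_mxcol !mxcolK.
  move: (submxcol h) => y /= hy.
  have : U *m (\col_i y i c 0) = 0.
    apply/colP => j; rewrite !mxE.
    have := congr1 (fun W => submxcol W j) hy; rewrite mxcolK submxcol0.
    move=> /colP/(_ c); rewrite summxE [in RHS]mxE => h0; rewrite -[RHS]h0.
    by apply: eq_bigr => k _; rewrite !mxE.
  move=> /nullU[a /colP ha].
  by have := ha i; have := ha i0; rewrite !mxE => -> ->.
rewrite -[h]submxcolK inner_mxcol.
under eq_bigr do rewrite hc innerC.
by rewrite -inner_sumr u0 inner0r.
Qed.

Lemma interior_segment (N : nat) (S : set 'cV[R]_N) (x h : 'cV[R]_N) :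
  interior S x -> exists2 t : R, 0 < t & S (x + t *: h).
Proof.
move=> /nbhs_ballP[e /= e0 he].
pose K := 1 + \sum_i `|h i 0|.
have hK i : `|h i 0| < K.
  rewrite /K (bigD1 i) //=.
  have : 0 <= \sum_(j | j != i) `|h j 0| by apply: sumr_ge0.
  lra.
have K0 : 0 < K by rewrite /K ltr_pwDl // sumr_ge0.
exists (e / K); first by rewrite divr_gt0.
apply: he; split=> // i j; rewrite /ball /= !mxE opprD addrA subrr add0r normrN normrM.
rewrite (ord1 j) gtr0_norm ?divr_gt0 // mulrAC -mulrA.
by rewrite -[ltRHS]mulr1 ltr_pM2l // ltr_pdivrMr // mul1r.
Qed.

(** The stacked problem has one multiplier [y], given to every agent, so [UU] annihilates the stack.
    Inclusion in [Y] must hold agent by agent, and [Z] redistributes the constraint values to make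
    this so. *)
Lemma saddle_point_exists : has_optimal_solution f A b g Om ->
  (exists xb : forall i, 'cV[R]_(n i),
      (forall i, interior (@Om i) (xb i)) /\
      \sum_(i < m) (A i *m xb i - b i) = 0 /\
      (forall j : 'I_q, (\sum_(i < m) g (xb i)) j 0 < 0)) ->
  exists x Y Z, Phi x Y Z 0.
Proof.
move=> [xs [[[Ks1 Ks2] Oxs] opt]] [xb [Oxb [Axb gxb]]].
pose F (X : 'cV[R]_(\sum_(i < m) n i)) := \sum_i f (submxcol X i).
pose AA : 'M[R]_(p, \sum_(i < m) n i) := \mxrow_i A i.
pose bb := \sum_i b i.
pose gg (X : 'cV[R]_(\sum_(i < m) n i)) := \sum_i g (submxcol X i).
pose OO : set 'cV[R]_(\sum_(i < m) n i) := [set X | forall i, Om (submxcol X i)].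
have subK (W : forall i, 'cV[R]_(n i)) i : submxcol (stack W) i = W i by exact: mxcolK.
have subL (t : R) (u w : 'cV[R]_(\sum_(i < m) n i)) i :
    submxcol (t *: u + (1 - t) *: w) i = t *: submxcol u i + (1 - t) *: submxcol w i.
  by apply/matrixP => k l; rewrite !mxE.
have AAE X : AA *m X - bb = \sum_i (A i *m submxcol X i - b i).
  by rewrite -{1}[X]submxcolK /AA mul_mxrow_mxcol sumrB.
have uG (x : forall i, 'cV[R]_(n i)) :
    usubmx (\sum_i G i (x i)) = \sum_i (A i *m x i - b i).
  by rewrite raddf_sum; apply: eq_bigr => i _; rewrite /= col_mxKu.
have dG (x : forall i, 'cV[R]_(n i)) : dsubmx (\sum_i G i (x i)) = \sum_i g (x i).
  by rewrite raddf_sum; apply: eq_bigr => i _; rewrite /= col_mxKd.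
have AAxs : AA *m stack xs = bb.
  by apply/eqP; rewrite -subr_eq0 AAE -[X in _ == X]Ks1 uG; under eq_bigr do rewrite subK.
have ggE x : gg (stack x) = \sum_i g (x i).
  by rewrite /gg; under eq_bigr do rewrite subK.
have [||||||||||mu [nu [nu0 hmul]]] :=
  @slater_multiplier R _ p q F AA bb gg OO (stack xs) (stack xb).
- move=> u w t t01; rewrite /F !mulr_sumr -big_split /=; apply: ler_sum => i _.
  by rewrite subL; exact: fc.
- move=> j u w t t01; rewrite /gg !summxE !mulr_sumr -big_split /=; apply: ler_sum => i _.
  by rewrite subL; exact: (gc j).
- by move=> u w t Ou Ow t01 i; rewrite subL; apply: Oc.
- by move=> i; rewrite subK.
- exact: AAxs.
- by move=> j; rewrite ggE -dG.
- move=> X OX AX gX.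
  have := opt (submxcol X); rewrite /F.
  under [X in _ -> X <= _]eq_bigr do rewrite subK.
  apply; split=> //; split; first by rewrite uG -AAE AX subrr.
  by move=> j; rewrite dG.
- move=> h; have /choice[t ht] i : exists t : R, 0 < t /\ Om (xb i + t *: submxcol h i).
    by have [t ? ?] := interior_segment (submxcol h i) (Oxb i); exists t.
  have [i|s /andP[s0 s1] hs] := @common_lower_bound R m t; first by have [] := ht i.
  exists s => // i.
  have [ti0 Oti] := ht i.
  have -> : submxcol (stack xb + s *: h) i =
      (s / t i) *: (xb i + t i *: submxcol h i) + (1 - s / t i) *: xb i.
    have -> : submxcol (stack xb + s *: h) i = xb i + s *: submxcol h i.
      by rewrite -[xb i]subK; apply/matrixP => k l; rewrite !mxE.
    rewrite scalerDr scalerA divfK ?gt_eqF //; move: (submxcol h i) => hi.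
    by apply/matrixP => k l; rewrite !mxE; ring.
  apply: Oc => //; first exact: interior_subset (Oxb i).
  by rewrite divr_ge0 ?(ltW s0) ?(ltW ti0) //= ler_pdivrMr // mul1r.
- by apply/eqP; rewrite -subr_eq0 AAE -[X in _ == X]Axb; under eq_bigr do rewrite subK.
- by move=> j; rewrite ggE.
pose y : 'cV[R]_(p + q) := col_mx mu nu.
have Ky : inKpol y by move=> j; rewrite col_mxKd.
have hy X : \sum_i inner y (G i (submxcol X i)) = inner mu (AA *m X - bb) + inner nu (gg X).
  rewrite AAE /gg !inner_sumr -big_split /=; apply: eq_bigr => i _.
  by rewrite inner_col_mx.
(* Complementary slackness: nonpositive by polarity of the cones, nonnegative by the multiplier
   inequality at [xs]. *)
have compl : \sum_i inner y (G i (xs i)) = 0.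
  have -> : \sum_i inner y (G i (xs i)) = \sum_i inner y (G i (submxcol (stack xs) i)).
    by apply: eq_bigr => i _; rewrite subK.
  apply/eqP; rewrite eq_le; apply/andP; split.
    rewrite -inner_sumr innerC; apply: inK_inner => //.
    by under eq_bigr do rewrite subK.
  have := hmul (stack xs); rewrite hy AAxs subrr inner0r add0r addr0 => h.
  by have := h _; rewrite lerDl; apply => i; rewrite subK.
(* The average constraint value lies in the cone and is orthogonal to [y], hence is normal to the
   polar cone at [y]. The choice of [Z] shifts every [G i (xs i)] to this average. *)
pose Gb : 'cV[R]_(p + q) := m%:R^-1 *: \sum_i G i (xs i).
have mn0 : 0 < m%:R :> R by rewrite ltr0n.
have [|Z hZ] := @sum0_in_range (fun i => G i (xs i) - Gb).
  rewrite sumrB sumr_const card_ord -scaler_nat scalerA mulfV ?gt_eqF //.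
  by rewrite scale1r subrr.
have GbK w : inKpol w -> inner Gb w <= 0.
  by move=> hw; rewrite innerZl pmulr_rle0 ?invr_gt0 //; apply: inK_inner.
have Gby : inner Gb y = 0 by rewrite innerZl innerC inner_sumr compl mulr0.
exists xs, (fun=> y), Z, 0, (UU^T *m Z); split; last split.
- split=> //; split; first by move=> i; rewrite subK.
  move=> X OX; rewrite inner0l addr0.
  under eq_bigr do rewrite subK.
  rewrite [leLHS]big_split [leRHS]big_split /= compl addr0 hy.
  have <- : F (stack xs) = \sum_i f (xs i) by apply: eq_bigr => i _; rewrite subK.
  by have := hmul X OX; rewrite /F addrA.
- exists (- (UU^T *m Z)); last by rewrite opprK.
  split=> //; split; first by move=> i; rewrite mxcolK.
  move=> W OW; rewrite -hZ -{1}[W]submxcolK.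
  move: (submxcol W) OW => w Ow.
  rewrite /stack -mxcolN -mxcolB inner_mxcol -big_split /=; apply: ler_sum => i _.
  rewrite !mxcolK.
  have := GbK _ (Ow i); have := Gby.
  rewrite !inner_lin (innerC (w i)) (innerC y); lra.
- by rewrite addNr kronI_consensus oppr0 !col_mx0.
Qed.

End KKT.

(** * The iterates as prediction and correction *)

Section Iterates.
Variables (L : 'M[R]_m) (theta alpha gamma : 'I_m -> R) (beta : R) (eps : nat -> 'I_m -> R).
Variables (x xh v : nat -> forall i, 'cV[R]_(n i)).
Variables (y yh lam : nat -> 'I_m -> 'cV[R]_(p + q)).
Variables (Z Zh : nat -> 'cV[R]_(\sum_(j < r) (p + q))).
Hypothesis LU : L = U^T *m U.
Hypothesis Ufree : row_free U.
Hypothesis fc : forall i, cvx_fun (f (i := i)).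
Hypothesis gc : forall i (j : 'I_q), cvx_fun (fun u => g (i := i) u j 0).
Hypothesis Oc : forall i, cvx_set (Om (i := i)).
Hypothesis alpha0 : forall i, 0 < alpha i.
Hypothesis gamma0 : forall i, 0 < gamma i.
Hypothesis beta0 : 0 < beta.
Hypothesis alg : inexact_DPMM f A b g Om L U theta alpha gamma beta eps x xh v y yh lam Z Zh.

Local Notation Q := (Qmat n (p + q) alpha gamma beta U).
Local Notation M := (Mmat n (p + q) theta gamma U).

Let xi k := xi_of (x k) (y k) (Z k).
Let xih k := xi_of (xh k) (yh k) (Zh k).
Let V k := col_mx (col_mx (stack (v k)) (0 : 'cV[R]_(\sum_(i < m) (p + q))))
                             (0 : 'cV[R]_(\sum_(j < r) (p + q))).

(** A right inverse of [U] makes its transpose injective, so identities on [Z] and [Zh] can be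
    checked on [lam]. *)
Lemma tr_kronI_inj (z z' : 'cV[R]_(\sum_(j < r) (p + q))) : UU^T *m z = UU^T *m z' -> z = z'.
Proof.
have /row_freeP[B UB] := Ufree.
have h : (kronI (p + q) B)^T *m UU^T = 1%:M.
  by rewrite -trmx_mul kronI_mul UB kronI1 trmx1.
by move=> e; rewrite -[z]mul1mx -[z']mul1mx -h -!mulmxA e.
Qed.

Let lamE k : stack (lam k) = UU^T *m Z k.
Proof. by case: alg => _ [_ [_ /(_ k)[_ [_ [_ [_ [_ [_ [_ []]]]]]]]]]. Qed.

Let lamhE k : stack (lam k.+1) = UU^T *m Zh k.
Proof. by case: alg => _ [_ [_ /(_ k)[_ [_ [_ [_ [_ [_ [_ []]]]]]]]]]. Qed.

Let ZS k : Z k.+1 = Zh k.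
Proof. by apply: tr_kronI_inj; rewrite -lamE -lamhE. Qed.

Let ZhE k : Zh k = Z k + beta *: (UU *m stack (yh k)).
Proof.
apply: tr_kronI_inj; rewrite -lamhE mulmxDr -lamE -scalemxAr mulmxA tr_kronI kronI_mul -LU.
rewrite /stack kronI_mxcol.
case: alg => _ [_ [_ /(_ k)[_ [_ [_ [_ [_ [lamS _]]]]]]]].
apply/mxcolP => i; rewrite submxcolD !mxcolK lamS; congr (_ + _).
pose S i := \sum_j L i j *: yh k j; rewrite -/(S i) -[in LHS](mxcolK S i).
by apply/matrixP => a c; rewrite !mxE.
Qed.

(** The off-diagonal block of [M] is the term [gamma i *: (lam k i - lam k.+1 i)] of the [y] update,
    and the third block says that [Z k.+1 = Zh k]. *)
Lemma dpmm_correction k : xi k.+1 = xi k - M *m (xi k - xih k).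
Proof.
rewrite /xi /xih /xi_of !opp_col_mx !add_col_mx Mmat_col !opp_col_mx !add_col_mx.
case: alg => _ [_ [_ /(_ k)[_ [_ [_ [_ [xS [_ [yS _]]]]]]]]].
congr (col_mx (col_mx _ _) _); last by rewrite subKr ZS.
- rewrite /stack -mxcolB bdiag_mxcol -mxcolB; apply: eq_mxcol => i; rewrite xS.
  by apply/matrixP => a c; rewrite !mxE; ring.
- rewrite mulmxBr -lamE -lamhE /stack -!mxcolB bdiag_mxcol -!mxcolB; apply: eq_mxcol => i.
  by rewrite yS; apply/matrixP => a c; rewrite !mxE; ring.
Qed.

(** The three blocks come from [subgrad_phik], from the variational inequality of the projection,
    and from the update of [Z]. *)
Lemma dpmm_prediction k : Phi (xh k) (yh k) (Zh k) (Q *m (xi k - xih k) + V k).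
Proof.
case: alg => _ [_ [_ /(_ k)[_ [hsub [_ [yhE _]]]]]].
have hsub' i := subgrad_phik (alpha0 i) (gamma0 i)
  (fc (i := i)) (gc (i := i)) (Oc (i := i)) (hsub i).
have Kyh i : inKpol (yh k i) by rewrite yhE; exact: inKpol_projKpol.
have Oxh i : Om (xh k i) by have [] := hsub i.
(* The displacement of the projection is [gamma i *: (u i + G)], which is normal to the polar cone
   at [yh k i]; hence [u i] is a subgradient of minus the Lagrangian in [y]. *)
pose u i := (gamma i)^-1 *: (y k i - yh k i) - lam k i.
exists (stack (fun i => (alpha i)^-1 *: (x k i - xh k i) + v k i)), (- stack u).
split; last split.
- split=> //; split; first by move=> i; rewrite mxcolK.
  move=> X OX; rewrite -[X in inner _ (X - _)]submxcolK /stack -mxcolB inner_mxcol -big_split /=.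
  apply: ler_sum => i _; rewrite mxcolK yhE.
  by have [_ /(_ _ (OX i))] := hsub' i.
- exists (stack u) => //; split=> //; split; first by move=> i; rewrite mxcolK.
  move=> W OW; rewrite -[X in inner _ (X - _)]submxcolK /stack -mxcolB inner_mxcol -big_split /=.
  apply: ler_sum => i _; rewrite mxcolK.
  have := projKpol_variational (y k i - gamma i *: lam k i
            + gamma i *: Gfun (A i) (b i) (@g i) (xh k i)) (OW i).
  rewrite -yhE; set GG := Gfun _ _ _ _; move: (submxcol W i) => w.
  have -> : y k i - gamma i *: lam k i + gamma i *: GG - yh k i = gamma i *: (u i + GG).
    rewrite /u scalerDr scalerBr scalerA mulfV ?gt_eqF // scale1r; move: GG => h.
    by apply/matrixP => a c; rewrite !mxE; ring.
  rewrite innerZl pmulr_rle0 // innerDl (innerDr GG) innerNr (innerC GG w) (innerC GG); lra.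
- rewrite /xi /xih /xi_of !opp_col_mx !add_col_mx Qmat_col // /V !add_col_mx !addr0.
  congr (col_mx (col_mx _ _) _).
  + rewrite /stack -mxcolB bdiag_mxcol -mxcolD; exact: eq_mxcol.
  + rewrite opprK (mulmxBr UU^T) -lamE /stack -mxcolB bdiag_mxcol opprB addrA [in RHS]mxcolB.
    by rewrite [RHS]addrAC.
  + rewrite ZhE opprD addrA subrr add0r scalerN scalerA mulVf ?gt_eqF // scale1r //.
Qed.

End Iterates.
End SaddleOperator.

Theorem theorem2 (R : realType) (m r p q : nat) (n : 'I_m -> nat)
    (f : forall i, 'cV[R]_(n i) -> R) (A : forall i, 'M[R]_(p, n i))
    (b : 'I_m -> 'cV[R]_p) (g : forall i, 'cV[R]_(n i) -> 'cV[R]_q)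
    (Om : forall i, set 'cV[R]_(n i))
    (E : rel 'I_m) (L : 'M[R]_m) (U : 'M[R]_(r, m))
    (theta alpha gamma : 'I_m -> R) (beta : R) (eps : nat -> 'I_m -> R)
    (x xh v : nat -> forall i, 'cV[R]_(n i))
    (y yh lam : nat -> 'I_m -> 'cV[R]_(p + q))
    (Z Zh : nat -> 'cV[R]_(\sum_(j < r) (p + q))) :
  (2 <= m)%N -> (forall i, 1 <= n i)%N ->
            
  (forall i j, E i j = E j i) -> (forall i j, connect E i j) ->
  L^T = L -> (forall i j, i != j -> ~~ E i j -> L i j = 0) ->
  (forall w : 'cV[R]_m, L *m w = 0 <-> exists c : R, w = c *: const_mx 1) ->
  L = U^T *m U -> row_free U -> U *m (const_mx 1 : 'cV[R]_m) = 0 ->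
            
  (forall i, cvx_fun (f i) /\ closed_fun (f i)) ->
  (forall i (j : 'I_q), cvx_fun (fun u => g i u j 0) /\ closed_fun (fun u => g i u j 0)) ->
  (forall i, Om i !=set0 /\ closed (Om i) /\ cvx_set (Om i)) ->
  has_optimal_solution f A b g Om ->
            
  (exists xb : forall i, 'cV[R]_(n i),
      (forall i, interior (Om i) (xb i)) /\
      \sum_(i < m) (A i *m xb i - b i) = 0 /\
      (forall j : 'I_q, (\sum_(i < m) g i (xb i)) j 0 < 0)) ->
                  
  (forall i, 0 < theta i < 2) -> (forall i, 0 < alpha i) -> (forall i, 0 < gamma i) ->
  0 < beta -> (forall i, 0 < gamma i * beta < (lambda_max L)^-1) ->
  (forall i, cvgn (fun N => \sum_(0 <= k < N) eps k i)) ->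
                    
  inexact_DPMM f A b g Om L U theta alpha gamma beta eps x xh v y yh lam Z Zh ->
  let H := Hmat n (p + q) theta alpha gamma beta U in
  let D := Dmat n (p + q) theta alpha gamma beta U in
  let M := Mmat n (p + q) theta gamma U in
  let xi := fun k => xi_of (x k) (y k) (Z k) in
  let xih := fun k => xi_of (xh k) (yh k) (Zh k) in
  let V := fun k => col_mx (col_mx (stack (v k)) (0 : 'cV[R]_(\sum_(i < m) (p + q))))
                             (0 : 'cV[R]_(\sum_(j < r) (p + q))) in
  (forall k : nat,
     wsqnorm H (M *m (xi k.+1 - xih k.+1))
     + wsqnorm D ((xi k - xih k) - (xi k.+1 - xih k.+1))
     <= wsqnorm H (M *m (xi k - xih k))
        + 2 * inner (xih k - xih k.+1) (V k - V k.+1)) /\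
  (forall tau : 'I_m -> R, (forall i, 0 < tau i < 1) ->
     (forall i, bigO_geom (fun k => eps k i) (tau i)) ->
     let tmax := \big[Num.max/0]_(i < m) tau i in
     o_inv_plus_O_geom (fun k => wsqnorm H (xi k.+1 - xi k)) tmax /\
     o_inv_plus_O_geom
       (fun k => (dist0 (PhiSet f A b g Om U (xh k) (yh k) (Zh k))) ^+ 2) tmax).
Proof.
move=> m2 _ _ _ _ _ Lnull LU Ufree U1 fcc gcc Occ opt slater theta02 alpha0 gamma0 beta0 step _ alg.
have m0 : (0 < m)%N by exact: ltnW.
have fc i : cvx_fun (f i) by have [] := fcc i.
have gc i j : cvx_fun (fun u => g i u j 0) by have [] := gcc i j.
have Oc i : cvx_set (Om i) by have [_ []] := Occ i.
have nullU (w : 'cV[R]_m) : U *m w = 0 -> exists c : R, w = c *: const_mx 1.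
  by move=> Uw; apply/Lnull; rewrite LU -mulmxA Uw mulmx0.
have stepU i : 0 < gamma i * beta < (lambda_max (U^T *m U))^-1 by rewrite -LU.
move=> H D M xi xih V.
have HM : H *m M = Qmat n (p + q) alpha gamma beta U by exact: Hmat_mul_Mmat.
have Hsym : H^T = H by exact: tr_Hmat.
have DE := @wsqnorm_Dmat R m r (p + q) n theta alpha gamma beta U theta02.
have corr k : xi k.+1 = xi k - M *m (xi k - xih k) := dpmm_correction Ufree alg k.
have pred := dpmm_prediction LU Ufree fc gc Oc alpha0 gamma0 beta0 alg.
have mono k := PhiSet_monotone (pred k) (pred k.+1).
split; first exact: (prediction_correction_step HM Hsym DE corr mono).
move=> tau tau01 hO tmax.
have i0 := Ordinal m0.
have taule i : tau i <= tmax by exact: le_bigmax.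
(* The maximum starts from the default 0, so the upper bound needs every [tau i < 1], and positivity
   comes from one agent. *)
have tmax01 : 0 < tmax < 1.
  apply/andP; split; first by apply: lt_le_trans (taule i0); have /andP[] := tau01 i0.
  by apply: bigmax_lt => // i _; have /andP[] := tau01 i.
have /choice[Ci hCi] i : exists C, 0 <= C /\ forall k, `|eps k i| <= C * tmax ^+ k.
  by apply: bigO_geom_all (hO i); rewrite taule andbT; have /andP[] := tau01 i.
pose C := \sum_i Ci i.
have C0 : 0 <= C by apply: sumr_ge0 => i _; have [] := hCi i.
have tk0 k : 0 <= tmax ^+ k by apply: exprn_ge0; apply: ltW; have /andP[] := tmax01.
have Vle k : sqnorm (V k) <= (C * tmax ^+ k) ^+ 2.
  rewrite /sqnorm !inner_col_mx !inner0r !addr0 inner_mxcol /C mulr_suml.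
  apply: le_trans (sum_sqr_le _); last first.
    by move=> i; rewrite mulr_ge0 //; have [] := hCi i.
  apply: ler_sum => i _; rewrite -/(sqnorm _) -enorm_sqr lerXn2r ?nnegrE ?sqrtr_ge0 //.
    by rewrite mulr_ge0 //; have [] := hCi i.
  have [_ [_ [_ /(_ k)[_ [_ [vle _]]]]]] := alg.
  apply: le_trans (vle i) _; apply: le_trans (ler_norm _) _.
  by have [_] := hCi i; exact.
(* This saddle point is the reference point of the Fejer argument. *)
have [xs [Ys [Zs sol]]] := saddle_point_exists m0 nullU U1 fc gc Oc opt slater.
have mono_sol k := PhiSet_monotone (pred k) sol.
have {}mono_sol k : 0 <= inner (xih k - xi_of xs Ys Zs)
    (Qmat n (p + q) alpha gamma beta U *m (xi k - xih k) + V k).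
  by have := mono_sol k; rewrite subr0.
have [CH [CH0 Hcoer]] :=
  @Hmat_coercive R m r (p + q) n theta alpha gamma beta U theta02 alpha0 gamma0 beta0.
have [CD [CD0 Dcoer]] :=
  @Dmat_coercive R m r (p + q) n theta alpha gamma beta U
    theta02 alpha0 gamma0 beta0 stepU m0.
have rate :=
  prediction_correction_rate HM Hsym DE corr mono mono_sol CH0 Hcoer CD0 Dcoer C0 tmax01 Vle.
split; apply: little_o_plus_O_geom.
  rewrite (_ : (fun k => _) = (fun k => k%:R * wsqnorm H (M *m (xi k - xih k)))) //.
  apply/funext => k; congr (_ * _).
  have -> : xi k.+1 - xi k = - (M *m (xi k - xih k)) by rewrite corr addrAC subrr add0r.
  by rewrite /wsqnorm mulmxN innerNl innerNr opprK.
have [C1 [C10 hC1]] := sqnorm_mulmx_bounded H.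
have tcvg : (fun k : nat => k%:R * tmax ^+ k) @ \oo --> (0 : R).
  by apply: natr_geom_cvg0; have /andP[/ltW-> ->] := tmax01.
(* The distance is bounded by the norm of [Q *m d + V k]: here [Q *m d = H *m (M *m d)] costs
   [C1 * CH] times the residual, and [sqnorm (V k)] is at most [C ^+ 2 * tmax ^+ k] since
   [tmax <= 1]. *)
apply: (natr_mul_cvg0_le (A := 2 * (C1 * CH)) (B := 2 * C ^+ 2) _ rate tcvg) => k.
rewrite sqr_ge0 /=; apply: le_trans (sqr_dist0_le (pred k)) _.
apply: le_trans (sqnormD_le _ _) _; apply: lerD.
  rewrite -mulrA ler_wpM2l // -HM -mulmxA; apply: le_trans (hC1 _) _.
  by rewrite -mulrA ler_wpM2l.
rewrite -mulrA ler_wpM2l //; apply: le_trans (Vle k) _.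
rewrite exprMn ler_wpM2l ?sqr_ge0 // expr2 ler_piMl //.
by apply: exprn_ile1; have /andP[/ltW t0 /ltW t1] := tmax01.
Qed.
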